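(* Let $g:\mathbb R\to\mathbb R$ be real-analytic with $g(0)=0$, $g'(0)=1$, and let $G(x)=\int_0^xg(s)\,ds$. Suppose there exist $a<0<b$ and $c>0$ such that $G(a)=G(b)=c$, and $G(x)<c$ and $x\,g(x)>0$ for all $a<x<b$, $x\ne0$. Then the equation $\ddot x+g(x)=0$ has an isochronous center at $0$ if and only if there exists a function $f$, real-analytic in some neighborhood of $0$, such that $$\frac{d}{dx}\left[\frac{G(x)}{g(x)^2}\right]=f(G(x))$$ for all $x$ in a neighborhood of $0$.
   Context: The equation $\ddot x+g(x)=0$ is identified with the planar system $\dot x=y$, $\dot y=-g(x)$. The center at the origin is called isochronous if all periodic orbits near $(0,0)$ have the same minimal period (which is then $2\pi$). The quotient $G/g^2$ extends analytically to $x=0$ with value $1/2$. *)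

(* Defs.v *)
From Stdlib Require Import Reals.
From Coquelicot Require Import Coquelicot.
Open Scope R_scope.

Definition analytic_at (f : R -> R) (x0 : R) : Prop :=
  exists a : nat -> R, locally x0 (fun x => is_pseries a (x - x0) (f x)).

Definition potential (g : R -> R) (x : R) : R := RInt g 0 x.

(* [G / g^2], where the removable singularity at the origin is filled in with
   its limit [1 / 2] (for [g 0 = 0] and [g' 0 = 1]). *)
Definition potential_quotient (g : R -> R) (x : R) : R :=
  if Req_EM_T x 0 then 1 / 2 else potential g x / (g x) ^ 2.

Definition solution (g x y : R -> R) : Prop :=
  forall t, is_derive x t (y t) /\ is_derive y t (- g (x t)).

Definition period (x y : R -> R) (T : R) : Prop :=
  0 < T /\ forall t, x (t + T) = x t /\ y (t + T) = y t.

(* Constant solutions have no minimal period, so a solution with a minimal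
   period parametrizes a genuine periodic orbit, not an equilibrium. *)
Definition minimal_period (x y : R -> R) (T : R) : Prop :=
  period x y T /\ forall S, period x y S -> T <= S.

Definition center_at_origin (g : R -> R) : Prop :=
  locally ((0, 0) : R * R) (fun p => p <> (0, 0) ->
    exists x y T, solution g x y /\ (x 0, y 0) = p /\ minimal_period x y T).

(* The system is autonomous, so every periodic orbit through a point [p] is
   parametrized by a solution with initial value [p]. *)
Definition isochronous_center_at_origin (g : R -> R) : Prop :=
  center_at_origin g /\
  exists T, locally ((0, 0) : R * R) (fun p =>
    forall x y S, solution g x y -> (x 0, y 0) = p -> minimal_period x y S ->
      S = T).

(* Main.v *)
(* Let [h] be the local inverse of [x |-> sgn(x) sqrt(2 G(x))] and [eta = h'].  In
   the variable [u] with [x = h u], the orbit of energy [r^2/2] is the circle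
   [u = r sin a], [y = r cos a], run through with [dt = eta(r sin a) da]; hence its
   period is the integral of [eta(r sin a)] over [0, 2 pi], which only sees the even
   part of [eta].  Since [G / g^2 = eta^2 / 2], its [x]-derivative [F] is [eta'(u)].

   If [F = f o G], then [eta'] is even, so [eta - 1] is odd and every period is [2 pi].

   Conversely, divide repeatedly by [G]: [K_0 = F], [K_(n+1) = (K_n - K_n(0)) / G].
   This is possible as long as [K_n'(0) = 0].  At the first failure
   [eta'(u) - eta'(-u)] would have a strict sign for small [u > 0], and the period would
   be strictly monotone in [r].  So under isochronicity the division never stops, and
   since it multiplies coefficient bounds by a constant factor, the series
   [f(v) = sum K_n(0) v^n] converges and [F = f o G]; neither composition nor
   inversion of power series is needed. *)
Require Import Defs.
From Stdlib Require Import Reals.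
From Coquelicot Require Import Coquelicot.
From Stdlib Require Import Lra Lia ClassicalEpsilon.
Open Scope R_scope.

(** * Power series with geometrically bounded coefficients *)

(** Explicit constants are tracked instead of a radius of convergence because the converse divides
    infinitely often: the growth of the constants at each division decides the convergence of the
    final series. *)
Definition geometric (a : nat -> R) (A B : R) : Prop :=
  forall n, Rabs (a n) <= A * B ^ n.

Lemma geometric_nonneg a A B : geometric a A B -> 0 <= A.
Proof.
  intros Ha; specialize (Ha 0%nat); simpl in Ha.
  pose proof (Rabs_pos (a 0%nat)); lra.
Qed.

Lemma geometric_weaken a A A' B B' :
  0 <= B <= B' -> A <= A' -> geometric a A B -> geometric a A' B'.
Proof.
  intros HB HA Ha n.
  pose proof (geometric_nonneg _ _ _ Ha).
  apply Rle_trans with (1 := Ha n).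
  apply Rmult_le_compat; try lra.
  - apply pow_le; lra.
  - apply pow_incr; lra.
Qed.

Lemma geometric_radius a A B x :
  0 < B -> geometric a A B -> Rabs x * B < 1 ->
  Rbar_lt (Rabs x) (CV_radius a).
Proof.
  intros HB Ha Hx.
  (* The midpoint between [Rabs x] and [/ B]: the terms stay bounded there, so the radius of
     convergence is at least [r], which exceeds [Rabs x]. *)
  set (r := (Rabs x + / B) / 2).
  assert (Hx' : Rabs x < / B).
  { apply Rmult_lt_reg_r with B; [easy|]; rewrite Rinv_l; lra. }
  pose proof (Rabs_pos x).
  apply Rbar_lt_le_trans with (Finite r); [simpl; unfold r; lra|].
  apply (proj1 (CV_radius_bounded a)).
  exists A; intros n.
  rewrite Rabs_mult, <- RPow_abs, (Rabs_pos_eq r) by (unfold r; lra).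
  pose proof (geometric_nonneg _ _ _ Ha).
  apply Rle_trans with (A * B ^ n * r ^ n).
  - apply Rmult_le_compat_r; [apply pow_le; unfold r; lra | apply Ha].
  - rewrite Rmult_assoc, <- Rpow_mult_distr.
    rewrite <- (Rmult_1_r A) at 2; apply Rmult_le_compat_l; [easy|].
    rewrite <- (pow1 n); apply pow_incr; unfold r; split.
    + apply Rmult_le_pos; lra.
    + replace (B * ((Rabs x + / B) / 2)) with ((Rabs x * B + 1) / 2)
        by (field; lra).
      lra.
Qed.

(** The majorant is a geometric series of ratio at most [1 / 2], whose sum is at most twice its
    first term. *)
Lemma geometric_PSeries a A B x :
  0 < B -> geometric a A B -> Rabs x * B <= 1 / 2 ->
  Rabs (PSeries a x) <= 2 * A.
Proof.
  intros HB Ha Hx.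
  pose proof (geometric_nonneg _ _ _ Ha) as HA.
  pose proof (Rabs_pos x) as Hx0.
  assert (Hq : Rabs (Rabs x * B) < 1).
  { rewrite Rabs_pos_eq; [lra | apply Rmult_le_pos; lra]. }
  assert (Hle : forall n, Rabs (a n * x ^ n) <= A * (Rabs x * B) ^ n).
  { intros n; rewrite Rabs_mult, <- RPow_abs, Rpow_mult_distr.
    replace (A * (Rabs x ^ n * B ^ n)) with (A * B ^ n * Rabs x ^ n) by ring.
    apply Rmult_le_compat_r; [apply pow_le; easy | apply Ha]. }
  assert (Hex : ex_series (fun n => A * (Rabs x * B) ^ n)).
  { apply (ex_series_scal A (fun n => (Rabs x * B) ^ n)), ex_series_geom; easy. }
  unfold PSeries.
  apply Rle_trans with (Series (fun n => Rabs (a n * x ^ n))).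
  - apply Series_Rabs.
    apply (ex_series_le (V := R_CompleteNormedModule)) with (2 := Hex).
    intros n; unfold norm; simpl; unfold abs; simpl.
    rewrite Rabs_Rabsolu; apply Hle.
  - apply Rle_trans with (1 := Series_le _ _ (fun n => conj (Rabs_pos _) (Hle n)) Hex).
    rewrite Series_scal_l, Series_geom by easy.
    rewrite (Rmult_comm 2); apply Rmult_le_compat_l; [easy|].
    rewrite <- (Rinv_inv 2); apply Rinv_le_contravar; lra.
Qed.

(** The terms of a convergent series tend to zero, hence are bounded; convergence at one point [x]
    thus gives the ratio [/ x]. *)
Lemma geometric_of_ex_pseries a x :
  0 < x -> ex_pseries a x -> exists A B, 0 < B /\ geometric a A B.
Proof.
  intros Hx Ha.
  apply ex_pseries_R in Ha.
  apply ex_series_lim_0 in Ha.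
  destruct (filterlim_bounded (K := R_AbsRing) (V := R_NormedModule) _
    (ex_intro _ 0 Ha)) as [M HM].
  exists M, (/ x); split; [apply Rinv_0_lt_compat; easy|].
  intros n; specialize (HM n).
  change (norm (a n * x ^ n)) with (Rabs (a n * x ^ n)) in HM.
  rewrite Rabs_mult, (Rabs_pos_eq (x ^ n)) in HM by (apply pow_le; lra).
  assert (0 < x ^ n) by (apply pow_lt; easy).
  rewrite pow_inv.
  apply Rmult_le_reg_r with (x ^ n); [easy|].
  rewrite Rmult_assoc, Rinv_l; lra.
Qed.

Lemma pow2_ge_INR n : INR (S n) <= 2 ^ n.
Proof.
  induction n as [|n IH]; [simpl; lra|].
  rewrite S_INR, <- tech_pow_Rmult.
  assert (1 <= 2 ^ n) by (apply pow_R1_Rle; lra).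
  lra.
Qed.

(** The factor [S n] produced by differentiation is absorbed by doubling the ratio. *)
Lemma geometric_derive a A B :
  0 < B -> geometric a A B -> geometric (PS_derive a) (A * B) (2 * B).
Proof.
  intros HB Ha n; unfold PS_derive.
  rewrite Rabs_mult, Rabs_pos_eq by apply pos_INR.
  rewrite Rpow_mult_distr.
  replace (A * B * (2 ^ n * B ^ n)) with (2 ^ n * (A * B ^ S n))
    by (simpl; ring).
  apply Rmult_le_compat; [apply pos_INR | apply Rabs_pos | apply pow2_ge_INR |
    apply Ha].
Qed.

Lemma geometric_shift a A B k :
  geometric a A B -> geometric (fun n => a (n + k)%nat) (A * B ^ k) B.
Proof.
  intros Ha n.
  apply Rle_trans with (1 := Ha (n + k)%nat).
  rewrite pow_add; apply Req_le; ring.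
Qed.

Lemma geometric_scal a A B c :
  geometric a A B -> geometric (fun n => c * a n) (Rabs c * A) B.
Proof.
  intros Ha n.
  rewrite Rabs_mult, Rmult_assoc.
  apply Rmult_le_compat_l; [apply Rabs_pos | apply Ha].
Qed.

(** * Division by a power series with constant term 1 *)

Lemma sum_geom_half (c : R) m : 0 <= c ->
  sum_f_R0 (fun i => c * (1 / 2) ^ i) m <= 2 * c.
Proof.
  intros Hc.
  enough (sum_f_R0 (fun i => c * (1 / 2) ^ i) m = 2 * c - c * (1 / 2) ^ m) as ->.
  { assert (0 <= c * (1 / 2) ^ m) by (apply Rmult_le_pos; [easy | apply pow_le; lra]).
    lra. }
  induction m as [|m IH]; simpl; [ring|].
  rewrite IH; simpl; field.
Qed.

(* Course-of-values recursion for the coefficients of [c / p], [p 0 = 1]: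
   row [m] of the iteration is already correct at all indices below [m]. *)
Fixpoint quotient_rows (p c : nat -> R) (m : nat) : nat -> R :=
  match m with
  | 0%nat => fun _ => 0
  | S m' => fun n => c n - match n with
      | 0%nat => 0
      | S k => sum_f_R0 (fun i => p (S i) * quotient_rows p c m' (k - i)%nat) k
      end
  end.

Definition PS_quotient (p c : nat -> R) (n : nat) : R :=
  quotient_rows p c (S n) n.

Lemma quotient_rows_stable p c n :
  forall m, (n < m)%nat -> quotient_rows p c m n = PS_quotient p c n.
Proof.
  induction n as [n IH] using Wf_nat.lt_wf_ind; intros [|m] Hm; [lia|].
  unfold PS_quotient; simpl; f_equal.
  destruct n as [|k]; [easy|].
  apply sum_eq; intros i Hi; f_equal.
  rewrite (IH (k - i)%nat) by lia.
  rewrite <- (IH (k - i)%nat) with (m := S k) by lia; easy.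
Qed.

Lemma PS_quotient_0 p c : PS_quotient p c 0 = c 0%nat.
Proof. unfold PS_quotient; simpl; ring. Qed.

Lemma PS_quotient_S p c k :
  PS_quotient p c (S k) =
    c (S k) - sum_f_R0 (fun i => p (S i) * PS_quotient p c (k - i)%nat) k.
Proof.
  unfold PS_quotient at 1; cbn [quotient_rows]; f_equal.
  apply sum_eq; intros i Hi; f_equal.
  apply (quotient_rows_stable p c (k - i) (S k)); lia.
Qed.

Lemma PS_mult_quotient p c n :
  p 0%nat = 1 -> PS_mult p (PS_quotient p c) n = c n.
Proof.
  intros Hp; unfold PS_mult; destruct n as [|k].
  - simpl; rewrite PS_quotient_0, Hp; ring.
  - rewrite decomp_sum by lia; simpl pred.
    cbn [Nat.sub]; rewrite PS_quotient_S, Hp.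
    ring.
Qed.

(** After rescaling by [b], the weights of the nonconstant coefficients sum to at most [1 / 2].
    Division by such a series keeps the ratio [b] and costs only a factor 2 in the constant. *)
Definition slowly_growing (p : nat -> R) (b : R) : Prop :=
  p 0%nat = 1 /\ 0 < b /\
  forall i, Rabs (p (S i)) <= b ^ S i * (1 / 4 * (1 / 2) ^ i).

Lemma slowly_growing_weaken p b b' :
  b <= b' -> slowly_growing p b -> slowly_growing p b'.
Proof.
  intros Hb (Hp0 & Hb0 & Hp); repeat split; [easy | lra |].
  intros i; apply Rle_trans with (1 := Hp i).
  apply Rmult_le_compat_r.
  - apply Rmult_le_pos; [lra | apply pow_le; lra].
  - apply pow_incr; lra.
Qed.

Lemma geometric_slowly_growing p A B :
  0 < B -> p 0%nat = 1 -> geometric p A B -> exists b, slowly_growing p b.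
Proof.
  intros HB Hp0 Hp.
  pose proof (geometric_nonneg _ _ _ Hp) as HA.
  (* The powers of 2 pay for the decay [(1 / 2) ^ i], and those of [1 + 4 * A] dominate the constant
     [A]. *)
  exists (2 * (1 + 4 * A) * B); repeat split; [easy | nra |].
  intros i; apply Rle_trans with (1 := Hp (S i)).
  rewrite Rpow_mult_distr.
  replace ((2 * (1 + 4 * A)) ^ S i * B ^ S i * (1 / 4 * (1 / 2) ^ i))
    with ((1 + 4 * A) ^ S i / 2 * (2 ^ i * (1 / 2) ^ i) * B ^ S i)
    by (rewrite Rpow_mult_distr; simpl; field).
  apply Rmult_le_compat_r; [apply pow_le; lra|].
  rewrite <- Rpow_mult_distr; replace (2 * (1 / 2)) with 1 by field; rewrite pow1.
  assert (H1 : 1 + 4 * A <= (1 + 4 * A) ^ S i).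
  { rewrite <- (pow_1 (1 + 4 * A)) at 1; apply Rle_pow; [lra | lia]. }
  lra.
Qed.

(** Strong induction on the recursion: if the earlier coefficients obey the bound with [2 * A], the
    weights of [p], of total at most [1 / 2], make the convolution at most [A * b ^ n], and [c n]
    contributes another [A * b ^ n]. *)
Lemma geometric_quotient p c A b :
  slowly_growing p b -> geometric c A b -> geometric (PS_quotient p c) (2 * A) b.
Proof.
  intros (Hp0 & Hb & Hp) Hc n.
  pose proof (geometric_nonneg _ _ _ Hc) as HA.
  induction n as [n IH] using Wf_nat.lt_wf_ind.
  destruct n as [|k].
  { rewrite PS_quotient_0; apply Rle_trans with (1 := Hc 0%nat); simpl; lra. }
  rewrite PS_quotient_S.
  pose proof (Hc (S k)) as HcS.
  assert (Hs : Rabs (sum_f_R0 (fun i => p (S i) * PS_quotient p c (k - i)%nat) k)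
     <= A * b ^ S k).
  { apply Rle_trans with (1 := Rsum_abs _ _).
    apply Rle_trans with
      (sum_f_R0 (fun i => A / 2 * b ^ S k * (1 / 2) ^ i) k).
    - apply sum_Rle; intros i Hi.
      rewrite Rabs_mult.
      apply Rle_trans with
        (b ^ S i * (1 / 4 * (1 / 2) ^ i) * (2 * A * b ^ (k - i))).
      + apply Rmult_le_compat; [apply Rabs_pos.. | apply Hp | apply IH; lia].
      + replace (S k) with (S i + (k - i))%nat by lia.
        rewrite (pow_add b (S i)); apply Req_le; field.
    - eapply Rle_trans; [apply sum_geom_half|].
      + apply Rmult_le_pos; [lra | apply pow_le; lra].
      + lra. }
  pose proof (Rabs_triang (c (S k))
    (- sum_f_R0 (fun i => p (S i) * PS_quotient p c (k - i)%nat) k)) as Ht.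
  rewrite Rabs_Ropp in Ht; unfold Rminus; lra.
Qed.

Lemma slowly_growing_geometric p b : slowly_growing p b -> geometric p 1 b.
Proof.
  intros (Hp0 & Hb & Hp) [|n].
  - rewrite Hp0, Rabs_R1; simpl; lra.
  - apply Rle_trans with (1 := Hp n).
    rewrite Rmult_comm; apply Rmult_le_compat_r; [apply pow_le; lra|].
    assert ((1 / 2) ^ n <= 1 ^ n) by (apply pow_incr; lra).
    rewrite pow1 in *; lra.
Qed.

Lemma PSeries_quotient p c A b x :
  slowly_growing p b -> geometric c A b -> Rabs x * b < 1 ->
  PSeries p x * PSeries (PS_quotient p c) x = PSeries c x.
Proof.
  intros Hp Hc Hx.
  assert (Hb : 0 < b) by apply Hp.
  rewrite <- PSeries_mult.
  - apply PSeries_ext; intros n; apply PS_mult_quotient, Hp.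
  - eapply geometric_radius; [exact Hb | apply slowly_growing_geometric, Hp | exact Hx].
  - eapply geometric_radius; [exact Hb | eapply geometric_quotient; eassumption | exact Hx].
Qed.

(** * Iterated division, recentring and analyticity *)

(** The relations telescope: [K 0] is a partial sum plus the remainder [v ^ S n * K (S n)], which
    decays like a power of [C * v]. It serves both for recentring a series, with [v = x - u], and
    for the final series, with [v] the potential. *)
Lemma iterated_division_series (K c : nat -> R) (v M C : R) :
  (forall n, K n = c n + v * K (S n)) ->
  (forall n, Rabs (K n) <= M * C ^ n) ->
  Rabs (C * v) < 1 ->
  is_series (fun n => c n * v ^ n) (K 0%nat).
Proof.
  intros HK HM Hv.
  assert (Hsum : forall n, sum_n (fun k => c k * v ^ k) n = K 0%nat - v ^ S n * K (S n)).
  { induction n as [|n IH].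
    - rewrite sum_O, (HK 0%nat); simpl; ring.
    - rewrite sum_Sn, IH, (HK (S n)); unfold plus; simpl; ring. }
  apply (is_lim_seq_ext (fun n => K 0%nat - v ^ S n * K (S n)) _ (K 0%nat)).
  { intros n; symmetry; apply Hsum. }
  replace (Finite (K 0%nat)) with (Rbar_minus (K 0%nat) 0) by (simpl; f_equal; ring).
  apply is_lim_seq_minus'; [apply is_lim_seq_const|].
  apply (is_lim_seq_incr_1 (fun n => v ^ n * K n)).
  apply is_lim_seq_abs_0.
  apply is_lim_seq_le_le with (fun _ => 0) (fun n => M * Rabs (C * v) ^ n).
  - intros n; split; [apply Rabs_pos|].
    rewrite Rabs_mult, Rabs_mult, Rpow_mult_distr, Rmult_comm, <- RPow_abs, <- Rmult_assoc.
    apply Rmult_le_compat_r; [apply pow_le, Rabs_pos|].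
    apply Rle_trans with (1 := HM n).
    apply Rmult_le_compat_l.
    + specialize (HM 0%nat); simpl in HM; pose proof (Rabs_pos (K 0%nat)); lra.
    + rewrite RPow_abs; apply Rle_abs.
  - apply is_lim_seq_const.
  - replace (Finite 0) with (Rbar_mult M 0) by (simpl; f_equal; ring).
    apply is_lim_seq_scal_l, is_lim_seq_geom; rewrite Rabs_Rabsolu; easy.
Qed.

(* Coefficients of [(a(x) - a(u)) / (x - u)]. *)
Definition PS_synthetic (u : R) (a : nat -> R) (n : nat) : R :=
  PSeries (fun j => a (j + S n)%nat) u.

Lemma geometric_synthetic u a A B :
  0 < B -> Rabs u * B <= 1 / 2 -> geometric a A B ->
  geometric (PS_synthetic u a) (A * (2 * B)) B.
Proof.
  intros HB Hu Ha n; unfold PS_synthetic.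
  eapply Rle_trans.
  - apply geometric_PSeries with (B := B); [easy | apply geometric_shift, Ha | easy].
  - simpl; apply Req_le; ring.
Qed.

Lemma PSeries_synthetic u x a A B :
  0 < B -> Rabs u * B <= 1 / 2 -> Rabs x * B < 1 -> geometric a A B ->
  PSeries a x = PSeries a u + (x - u) * PSeries (PS_synthetic u a) x.
Proof.
  intros HB Hu Hx Ha.
  pose proof (geometric_synthetic _ _ _ _ HB Hu Ha) as Hb.
  set (b := PS_synthetic u a) in *.
  (* Horner's recurrence: splitting off the first term of a tail at [u] leaves [u] times the next
     tail. *)
  assert (Hba : forall n, PSeries (fun j => a (j + n)%nat) u = a n + u * b n).
  { intros n; rewrite PSeries_decr_1.
    - simpl; f_equal; f_equal; unfold b, PS_synthetic.
      apply PSeries_ext; intros j; unfold PS_decr_1; f_equal; lia.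
    - apply CV_radius_inside.
      apply geometric_radius with (A * B ^ n) B; [easy | apply geometric_shift, Ha | lra]. }
  assert (Eb : ex_pseries b x).
  { apply CV_radius_inside; eapply geometric_radius; eauto. }
  assert (Ea : ex_pseries a x).
  { apply CV_radius_inside; eapply geometric_radius; eauto. }
  rewrite (PSeries_decr_1 a x Ea).
  assert (H0 : PSeries a u = a 0%nat + u * b 0%nat).
  { rewrite <- Hba; apply PSeries_ext; intros; f_equal; lia. }
  assert (Ed : PSeries (PS_decr_1 a) x = PSeries b x - u * PSeries (PS_decr_1 b) x).
  { rewrite <- (PSeries_scal u), <- PSeries_minus; [|easy|].
    - apply PSeries_ext; intros n.
      unfold PS_decr_1, PS_minus, PS_plus, PS_opp, PS_scal, plus, opp, scal; simpl.
      unfold mult; simpl.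
      pose proof (Hba (S n)); unfold b, PS_synthetic in *; lra.
    - apply ex_pseries_scal; [apply Rmult_comm | apply ex_pseries_decr_1; [|easy]].
      destruct (Req_dec x 0) as [->|Hx0]; [left; easy | right].
      exists (/ x); unfold mult, one; simpl; field; easy. }
  pose proof (PSeries_decr_1 b x Eb) as Hb1.
  rewrite Ed, H0.
  replace (x * (PSeries b x - u * PSeries (PS_decr_1 b) x))
    with (x * PSeries b x - u * (x * PSeries (PS_decr_1 b) x)) by ring.
  replace (x * PSeries (PS_decr_1 b) x) with (PSeries b x - b 0%nat) by lra.
  ring.
Qed.

(** Repeated synthetic division at [u] yields the Taylor coefficients there, with no rearrangement
    of a double series. Each division multiplies the constant by [2 * B], so the new series
    converges on the ball of radius [/ (4 * B)], where also [Rabs x * B <= 1 / 2]. *)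
Lemma analytic_at_PSeries a A B u :
  0 < B -> geometric a A B -> Rabs u * B <= 1 / 4 -> analytic_at (PSeries a) u.
Proof.
  intros HB Ha Hu.
  set (K := fun n => Nat.iter n (PS_synthetic u) a).
  assert (HK : forall n, geometric (K n) (A * (2 * B) ^ n) B).
  { induction n as [|n IH]; simpl.
    - rewrite Rmult_1_r; easy.
    - apply geometric_weaken with (A * (2 * B) ^ n * (2 * B)) B; [lra | right; ring |].
      apply geometric_synthetic; [easy | lra | apply IH]. }
  exists (fun n => PSeries (K n) u).
  assert (Hd : 0 < / (4 * B)) by (apply Rinv_0_lt_compat; lra).
  exists (mkposreal _ Hd); intros x Hx.
  change (Rabs (x - u) < / (4 * B)) in Hx.
  assert (HxB : Rabs (x - u) * B < 1 / 4).
  { replace (1 / 4) with (/ (4 * B) * B) by (field; lra).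
    apply Rmult_lt_compat_r; easy. }
  assert (Hxx : Rabs x * B <= 1 / 2).
  { pose proof (Rabs_triang (x - u) u) as Ht.
    rewrite Rplus_comm, Rplus_minus in Ht.
    apply Rle_trans with ((Rabs (x - u) + Rabs u) * B); [|lra].
    apply Rmult_le_compat_r; lra. }
  apply is_pseries_R.
  apply (iterated_division_series (fun n => PSeries (K n) x) _ _ (2 * A) (2 * B)).
  - intros n; apply PSeries_synthetic with (A * (2 * B) ^ n) B; [easy | lra.. | apply HK].
  - intros n; eapply Rle_trans; [eapply geometric_PSeries; [exact HB | apply HK | easy]|].
    apply Req_le; ring.
  - rewrite Rabs_mult, Rabs_pos_eq; lra.
Qed.

Lemma analytic_at_expansion f x0 :
  analytic_at f x0 -> exists a A B e, 0 < B /\ geometric a A B /\ 0 < e /\ e * B <= 1 / 2 /\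
    forall x, Rabs (x - x0) < e -> f x = PSeries a (x - x0).
Proof.
  intros [a [e He]].
  assert (Hball : forall x, Rabs (x - x0) < e -> is_pseries a (x - x0) (f x)) by exact He.
  pose proof (cond_pos e) as Hpos.
  destruct (geometric_of_ex_pseries a (e / 2)) as (A & B & HB & Ha); [lra| |].
  { exists (f (x0 + e / 2)).
    pose proof (Hball (x0 + e / 2)) as H.
    replace (x0 + e / 2 - x0) with (e / 2) in H by ring.
    apply H; rewrite Rabs_pos_eq; lra. }
  exists a, A, B, (Rmin e (/ (2 * B))).
  assert (0 < / (2 * B)) by (apply Rinv_0_lt_compat; lra).
  repeat split; [easy | easy | apply Rmin_pos; easy | |].
  - apply Rle_trans with (/ (2 * B) * B).
    + apply Rmult_le_compat_r; [lra | apply Rmin_r].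
    + right; field; lra.
  - intros x Hx; symmetry; apply is_pseries_unique, Hball.
    apply Rlt_le_trans with (1 := Hx), Rmin_l.
Qed.

Lemma analytic_at_ex_derive f x : analytic_at f x -> ex_derive f x.
Proof.
  intros Hf.
  destruct (analytic_at_expansion f x Hf) as (a & A & B & e & HB & Ha & He & HeB & Hfa).
  apply ex_derive_ext_loc with (fun y => PSeries a (y - x)).
  { exists (mkposreal e He); intros y Hy; symmetry; apply Hfa, Hy. }
  apply ex_derive_comp.
  - apply ex_derive_PSeries; apply geometric_radius with A B; [easy..|].
    rewrite Rminus_diag, Rabs_R0; lra.
  - auto_derive; easy.
Qed.

(** The difference quotient of two points is a value of the synthetic quotient, whose coefficients
    are bounded uniformly in the base point. *)
Lemma analytic_at_lipschitz f x0 :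
  analytic_at f x0 -> exists e L, 0 < e /\ 0 <= L /\
    forall x y, Rabs (x - x0) < e -> Rabs (y - x0) < e ->
      Rabs (f x - f y) <= L * Rabs (x - y).
Proof.
  intros Hf.
  destruct (analytic_at_expansion f x0 Hf) as (a & A & B & e & HB & Ha & He & HeB & Hfa).
  pose proof (geometric_nonneg _ _ _ Ha).
  exists e, (2 * (A * (2 * B))); repeat split; [easy | nra |].
  assert (Hsmall : forall z, Rabs (z - x0) < e -> Rabs (z - x0) * B <= 1 / 2).
  { intros z Hz; apply Rle_trans with (e * B); [apply Rmult_le_compat_r|]; lra. }
  intros x y Hx Hy.
  rewrite (Hfa x Hx), (Hfa y Hy).
  rewrite (PSeries_synthetic (y - x0) (x - x0) a A B HB (Hsmall y Hy)); [|specialize (Hsmall x Hx); lra | easy].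
  replace (x - x0 - (y - x0)) with (x - y) by ring.
  rewrite Rplus_minus_l, Rabs_mult, Rmult_comm.
  apply Rmult_le_compat_r; [apply Rabs_pos|].
  apply geometric_PSeries with B; [easy | apply geometric_synthetic; auto | auto].
Qed.

(** * The straightening coordinate *)

Lemma is_derive_continuous (f : R -> R) x l : is_derive f x l -> continuous f x.
Proof. intros H; apply (ex_derive_continuous (V := R_NormedModule)); exists l; exact H. Qed.

Lemma mean_value (f df : R -> R) a b :
  (forall x, Rmin a b <= x <= Rmax a b -> is_derive f x (df x)) ->
  exists c, Rmin a b <= c <= Rmax a b /\ f b - f a = df c * (b - a).
Proof.
  intros H; apply MVT_gen; intros x Hx; [apply H; lra|].
  apply continuity_pt_filterlim.
  exact (is_derive_continuous _ _ _ (H x Hx)).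
Qed.

Lemma derive_zero_constant (f : R -> R) a b :
  (forall x, Rmin a b <= x <= Rmax a b -> is_derive f x 0) -> f a = f b.
Proof.
  intros H; destruct (mean_value f (fun _ => 0) a b H) as (c & _ & Hc); lra.
Qed.

Lemma derive_lower_bound (f df : R -> R) m a b :
  (forall x, is_derive f x (df x)) -> (forall x, m <= df x) -> a <= b ->
  m * (b - a) <= f b - f a.
Proof.
  intros Hf Hm Hab.
  destruct (mean_value f df a b) as (c & _ & ->); [intros; apply Hf|].
  apply Rmult_le_compat_r; [lra | apply Hm].
Qed.

Lemma is_derive_RInt_continuous (f : R -> R) x :
  (forall y, continuous f y) -> is_derive (RInt f 0) x (f x).
Proof.
  intros Hf; apply (is_derive_RInt (V := R_NormedModule) f (RInt f 0) 0 x); [|apply Hf].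
  apply filter_forall; intros y.
  apply (RInt_correct (V := R_CompleteNormedModule)).
  apply (ex_RInt_continuous (V := R_CompleteNormedModule)); intros; apply Hf.
Qed.

Lemma is_derive_intro (f : R -> R) x l :
  (forall eps : posreal, locally x (fun y =>
     Rabs (f y - f x - (y - x) * l) <= eps * Rabs (y - x))) ->
  is_derive f x l.
Proof.
  intros H; split; [apply is_linear_scal_l|].
  intros z Hz.
  apply (is_filter_lim_locally_unique (K := R_AbsRing) (V := AbsRing_NormedModule R_AbsRing)) in Hz.
  subst z; intros eps; exact (H eps).
Qed.

Lemma is_derive_elim (f : R -> R) x l :
  is_derive f x l -> forall eps : posreal, exists d, 0 < d /\
    forall y, Rabs (y - x) < d ->
      Rabs (f y - f x - (y - x) * l) <= eps * Rabs (y - x).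
Proof.
  intros [_ H] eps.
  destruct (H x (fun P HP => HP) eps) as [d Hd].
  exists d; split; [apply cond_pos|].
  intros y Hy; exact (Hd y Hy).
Qed.

(** A slope of at least [m] makes [f] expand distances, which gives injectivity and a Lipschitz
    inverse, and makes [f] unbounded on both sides, which gives surjectivity. It is applied to the
    straightening coordinate and to the time along an orbit. *)
Lemma expanding_inverse (f df : R -> R) m :
  0 < m -> (forall x, is_derive f x (df x)) -> (forall x, m <= df x) ->
  exists k, (forall y, f (k y) = y) /\ (forall x, k (f x) = x) /\
    forall y, is_derive k y (/ df (k y)).
Proof.
  intros Hm Hf Hlb.
  assert (Hexp : forall x y, m * Rabs (x - y) <= Rabs (f x - f y)).
  { intros x y; destruct (Rle_dec x y) as [Hxy|Hxy].
    - pose proof (derive_lower_bound f df m x y Hf Hlb Hxy).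
      rewrite (Rabs_minus_sym x), (Rabs_minus_sym (f x)), !Rabs_pos_eq; nra.
    - assert (Hyx : y <= x) by lra.
      pose proof (derive_lower_bound f df m y x Hf Hlb Hyx).
      rewrite !Rabs_pos_eq; nra. }
  assert (Hsurj : forall y, exists x, f x = y).
  (* Over the distance [r] the function moves by at least [Rabs (y - f 0)], so [y] lies between
     [f (- r)] and [f r]. *)
  { intros y; set (r := Rabs (y - f 0) / m).
    assert (Hr : m * r = Rabs (y - f 0)) by (unfold r; field; lra).
    assert (Hr0 : 0 <= r).
    { apply Rmult_le_reg_l with m; [easy|]; rewrite Hr, Rmult_0_r; apply Rabs_pos. }
    pose proof (derive_lower_bound f df m 0 r Hf Hlb Hr0) as H1.
    assert (H2 := derive_lower_bound f df m (- r) 0 Hf Hlb).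
    specialize (H2 ltac:(lra)).
    pose proof (Rle_abs (y - f 0)); pose proof (Rle_abs (- (y - f 0))) as H3.
    rewrite Rabs_Ropp in H3.
    destruct (IVT_gen f (- r) r y) as (x & _ & Hx).
    - intros z; apply continuity_pt_filterlim; exact (is_derive_continuous _ _ _ (Hf z)).
    - assert (f (- r) <= y <= f r) by nra.
      rewrite Rmin_left, Rmax_right; lra.
    - exists x; exact Hx. }
  set (k := fun y => proj1_sig (constructive_indefinite_description _ (Hsurj y))).
  assert (Hfk : forall y, f (k y) = y) by (intros y; unfold k; apply proj2_sig).
  exists k; split; [easy | split].
  { intros x; specialize (Hexp (k (f x)) x); rewrite Hfk, Rminus_diag, Rabs_R0 in Hexp.
    pose proof (Rabs_pos (k (f x) - x)).
    destruct (Req_dec (k (f x) - x) 0) as [H0|H0]; [lra|].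
    apply Rabs_pos_lt in H0; nra. }
  intros y; apply is_derive_intro; intros eps.
  set (d := df (k y)).
  assert (Hd : 0 < d) by (unfold d; specialize (Hlb (k y)); lra).
  (* The tolerance for [f]: the factor [m] converts distances of preimages into distances of values,
     and [d] cancels the division by the slope. *)
  assert (He : 0 < eps * d * m).
  { apply Rmult_lt_0_compat; [apply Rmult_lt_0_compat; [apply cond_pos|]|]; easy. }
  destruct (is_derive_elim _ _ _ (Hf (k y)) (mkposreal _ He)) as (r & Hr & Hfr).
  assert (Hmr : 0 < m * r) by nra.
  exists (mkposreal _ Hmr); intros z Hz.
  change (Rabs (z - y) < m * r) in Hz.
  pose proof (Hexp (k z) (k y)) as Hzy; rewrite !Hfk in Hzy.
  specialize (Hfr (k z)); simpl in Hfr; rewrite !Hfk in Hfr; fold d in Hfr.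
  assert (Hk : Rabs (k z - k y) < r) by (apply Rmult_lt_reg_l with m; lra).
  specialize (Hfr Hk).
  replace (k z - k y - (z - y) * / d) with (- (z - y - (k z - k y) * d) / d)
    by (field; lra).
  unfold Rdiv; rewrite Rabs_mult, Rabs_Ropp, (Rabs_pos_eq (/ d))
    by (left; apply Rinv_0_lt_compat; easy).
  apply Rmult_le_reg_r with d; [easy|].
  rewrite Rmult_assoc, Rinv_l, Rmult_1_r by lra.
  apply Rle_trans with (1 := Hfr).
  replace (eps * d * m * Rabs (k z - k y)) with (eps * d * (m * Rabs (k z - k y))) by ring.
  replace (eps * Rabs (z - y) * d) with (eps * d * Rabs (z - y)) by ring.
  apply Rmult_le_compat_l; [|easy].
  apply Rmult_le_pos; [left; apply cond_pos | lra].
Qed.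

(** * Normal form of the force and construction of the coordinate *)

Lemma slowly_growing_near_1 p b x :
  slowly_growing p b -> Rabs x * b <= 1 / 2 -> Rabs (PSeries p x - 1) <= 1 / 4.
Proof.
  intros Hp Hx.
  pose proof (slowly_growing_geometric _ _ Hp) as Hg.
  destruct Hp as (Hp0 & Hb & Hp).
  rewrite PSeries_decr_1, Hp0.
  2: { apply CV_radius_inside, geometric_radius with 1 b; [easy..|lra]. }
  rewrite Rplus_minus_l, Rabs_mult.
  assert (H : Rabs (PSeries (PS_decr_1 p) x) <= 2 * (b / 4)).
  { apply geometric_PSeries with b; [easy | | easy].
    intros i; unfold PS_decr_1; apply Rle_trans with (1 := Hp i).
    assert (H1 : (1 / 2) ^ i <= 1 ^ i) by (apply pow_incr; lra).
    rewrite pow1 in H1; simpl.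
    assert (0 < b ^ i) by (apply pow_lt; easy).
    assert (0 < b * b ^ i) by (apply Rmult_lt_0_compat; easy).
    nra. }
  apply Rle_trans with (Rabs x * (2 * (b / 4))).
  - apply Rmult_le_compat_l; [apply Rabs_pos | easy].
  - lra.
Qed.

Lemma force_normal_form g :
  analytic_at g 0 -> g 0 = 0 -> is_derive g 0 1 ->
  exists p P b e, slowly_growing p b /\ slowly_growing P b /\ 0 < e /\ e * b <= 1 / 2 /\
    forall x, Rabs x < e ->
      g x = x * PSeries p x /\ potential g x = x ^ 2 / 2 * PSeries P x.
Proof.
  intros Hg g0 dg0.
  destruct (analytic_at_expansion g 0 Hg) as (a & A & B & e & HB & Ha & He & HeB & Hga').
  assert (Hga : forall x, Rabs x < e -> g x = PSeries a x).
  { intros x Hx; rewrite Hga'; [f_equal; ring|]; rewrite Rminus_0_r; easy. }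
  assert (Hrad : forall x, Rabs x < e -> Rbar_lt (Rabs x) (CV_radius a)).
  { intros x Hx; apply geometric_radius with A B; [easy..|].
    apply Rle_lt_trans with (1 / 2); [|lra].
    apply Rle_trans with (2 := HeB), Rmult_le_compat_r; lra. }
  assert (H0e : Rabs 0 < e) by (rewrite Rabs_R0; easy).
  assert (Ha0 : a 0%nat = 0) by (rewrite <- PSeries_0, <- Hga; easy).
  assert (Ha1 : a 1%nat = 1).
  { pose proof (is_derive_PSeries a 0 (Hrad 0 H0e)) as Hd.
    rewrite PSeries_0 in Hd; unfold PS_derive in Hd; simpl in Hd; rewrite Rmult_1_l in Hd.
    rewrite <- (is_derive_unique _ _ _ Hd), <- (is_derive_unique _ _ _ dg0).
    apply Derive_ext_loc; exists (mkposreal e He); intros y Hy; symmetry; apply Hga.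
    change (Rabs (y - 0) < e) in Hy; rewrite Rminus_0_r in Hy; easy. }
  set (p := fun n => a (n + 1)%nat).
  (* Termwise integration of the force, with [x ^ 2 / 2] split off; the factor 2 makes the constant
     term 1. *)
  set (P := fun n => 2 * (a (n + 1)%nat / INR (S (S n)))).
  assert (Hp : geometric p (A * B ^ 1) B) by apply geometric_shift, Ha.
  assert (HP : geometric P (A * B ^ 1) B).
  { intros n; apply Rle_trans with (2 := Hp n); unfold P, p.
    rewrite !S_INR; pose proof (pos_INR n).
    replace (2 * (a (n + 1)%nat / (INR n + 1 + 1)))
      with (a (n + 1)%nat * (2 / (INR n + 2))) by (field; lra).
    rewrite Rabs_mult, (Rabs_pos_eq (2 / _)).
    - rewrite <- (Rmult_1_r (Rabs (a _))) at 2.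
      apply Rmult_le_compat_l; [apply Rabs_pos|].
      apply Rmult_le_reg_r with (INR n + 2); [lra|]; field_simplify; lra.
    - apply Rmult_le_pos; [lra | left; apply Rinv_0_lt_compat; lra]. }
  destruct (geometric_slowly_growing p _ B HB Ha1 Hp) as [b1 Hb1].
  destruct (fun H => geometric_slowly_growing P _ B HB H HP) as [b2 Hb2].
  { unfold P; simpl; rewrite Ha1; field. }
  pose proof (Rmax_l b1 b2); pose proof (Rmax_r b1 b2).
  assert (Hb : 0 < Rmax b1 b2) by (destruct Hb1 as (_ & ? & _); lra).
  assert (Hbi : 0 < / (2 * Rmax b1 b2)) by (apply Rinv_0_lt_compat; lra).
  exists p, P, (Rmax b1 b2), (Rmin e (/ (2 * Rmax b1 b2))).
  split; [apply slowly_growing_weaken with b1; easy|].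
  split; [apply slowly_growing_weaken with b2; easy|].
  repeat split.
  - apply Rmin_pos; easy.
  - apply Rle_trans with (/ (2 * Rmax b1 b2) * Rmax b1 b2).
    + apply Rmult_le_compat_r; [lra | apply Rmin_r].
    + right; field; lra.
  - assert (Hx : Rabs x < e) by (apply Rlt_le_trans with (1 := H1), Rmin_l).
    rewrite Hga, PSeries_decr_1_aux by easy; f_equal.
    apply PSeries_ext; intros n; unfold PS_decr_1, p; f_equal; lia.
  - assert (Hx : Rabs x < e) by (apply Rlt_le_trans with (1 := H1), Rmin_l).
    unfold potential; rewrite (RInt_ext g (PSeries a)).
    + rewrite RInt_PSeries by (apply Hrad; easy).
      rewrite (PSeries_decr_n_aux _ 2).
      * replace (x ^ 2 / 2 * PSeries P x) with (x ^ 2 * (1 / 2 * PSeries P x)) by field.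
        f_equal; rewrite <- PSeries_scal; apply PSeries_ext; intros n.
        unfold PS_decr_n, PS_scal, P, scal; simpl; unfold mult; simpl.
        rewrite Nat.add_1_r; field.
        pose proof (pos_INR n); destruct n; simpl in *; lra.
      * intros [|[|k]] Hk; [easy | simpl; rewrite Ha0; lra | lia].
    + intros y Hy; apply Hga; revert Hx Hy; unfold Rmin, Rmax, Rabs.
      repeat destruct Rle_dec; repeat destruct Rcase_abs; lra.
Qed.

(* [h] straightens the potential, [G (h u) = u ^ 2 / 2], so that orbits of energy
   [r ^ 2 / 2] become circles of radius [r] in the [(u, y)] plane; [eta = h']. *)
Record straightening (g X h eta : R -> R) (rho : R) : Prop := {
  str_rho : 0 < rho;
  str_X_h : forall u, X (h u) = u;
  str_h_X : forall x, h (X x) = x;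
  str_X_cont : forall x, continuous X x;
  str_h_0 : h 0 = 0;
  str_h_derive : forall u, is_derive h u (eta u);
  str_eta_cont : forall u, continuous eta u;
  str_eta_lower : forall u, 1 / 2 <= eta u;
  str_h_bound : forall u, Rabs (h u) <= 2 * Rabs u;
  str_force : forall u, Rabs u < rho -> g (h u) * eta u = u;
  str_potential : forall u, Rabs u < rho -> potential g (h u) = u ^ 2 / 2;
  str_quotient : forall u, Rabs u < rho -> eta u ^ 2 = 2 * potential_quotient g (h u)
}.

(** Freezes a locally defined slope outside an interval, so that its integral is defined and
    invertible on the whole line. *)
Definition clamp (r x : R) : R := Rmax (- r) (Rmin r x).

Lemma clamp_bound r x : 0 <= r -> Rabs (clamp r x) <= r.
Proof.
  intros Hr; apply Rabs_le; unfold clamp, Rmax, Rmin.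
  repeat destruct Rle_dec; lra.
Qed.

Lemma clamp_id r x : Rabs x <= r -> clamp r x = x.
Proof.
  intros Hx; apply Rabs_le_between in Hx; unfold clamp.
  rewrite Rmin_right, Rmax_right; lra.
Qed.

Lemma clamp_continuous r x : 0 <= r -> continuous (clamp r) x.
Proof.
  intros Hr.
  apply continuous_ext with (fun x => (Rabs (x + r) - Rabs (x - r)) / 2).
  { intros y; unfold clamp, Rmax, Rmin, Rabs.
    repeat destruct Rle_dec; repeat destruct Rcase_abs; lra. }
  apply (continuous_mult (K := R_AbsRing) (fun x => Rabs (x + r) - Rabs (x - r))
    (fun _ => / 2)); [|apply continuous_const].
  apply (continuous_minus (V := R_NormedModule));
    apply continuous_Rabs_comp, (ex_derive_continuous (V := R_NormedModule)); auto_derive; easy.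
Qed.

Lemma PSeries_is_derive_geometric a A B x :
  0 < B -> geometric a A B -> Rabs x * B < 1 ->
  is_derive (PSeries a) x (PSeries (PS_derive a) x).
Proof.
  intros HB Ha Hx; apply is_derive_PSeries; eapply geometric_radius; eauto.
Qed.

(** Cancelling [x ^ 2] turns the quotient into [P / (2 * p ^ 2)], so two divisions by [p] suffice;
    the constants grow from [1 / 2] to 1 to 2. At the origin the series takes the filled-in value
    [1 / 2]. *)
Lemma potential_quotient_PSeries g p P b e :
  slowly_growing p b -> slowly_growing P b -> e * b <= 1 / 2 ->
  (forall x, Rabs x < e -> g x = x * PSeries p x /\ potential g x = x ^ 2 / 2 * PSeries P x) ->
  exists q, geometric q 2 b /\
    forall x, Rabs x < e -> potential_quotient g x = PSeries q x /\
      2 * potential_quotient g x * PSeries p x ^ 2 = PSeries P x.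
Proof.
  intros Hp HP Heb Hg.
  assert (Hb : 0 < b) by apply Hp.
  set (c := fun n => 1 / 2 * P n).
  assert (Hc : geometric c (1 / 2) b).
  { pose proof (geometric_scal _ _ _ (1 / 2) (slowly_growing_geometric _ _ HP)) as H.
    rewrite (Rabs_pos_eq (1 / 2)), Rmult_1_r in H; [exact H | lra]. }
  pose proof (geometric_quotient _ _ _ _ Hp Hc) as Hq1.
  pose proof (geometric_quotient _ _ _ _ Hp Hq1) as Hq2.
  exists (PS_quotient p (PS_quotient p c)); split.
  { apply geometric_weaken with (3 := Hq2); lra. }
  intros x Hx.
  assert (Hxb : Rabs x * b <= 1 / 2).
  { apply Rle_trans with (2 := Heb), Rmult_le_compat_r; lra. }
  pose proof (slowly_growing_near_1 _ _ _ Hp Hxb) as Hp1.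
  apply Rabs_le_between in Hp1.
  assert (Hxb' : Rabs x * b < 1) by lra.
  pose proof (PSeries_quotient p c _ b x Hp Hc Hxb') as E1.
  pose proof (PSeries_quotient p _ _ b x Hp Hq1 Hxb') as E2.
  assert (Ec : PSeries c x = 1 / 2 * PSeries P x) by apply PSeries_scal.
  set (q := PSeries (PS_quotient p (PS_quotient p c)) x) in *.
  assert (E : 2 * q * PSeries p x ^ 2 = PSeries P x) by nra.
  enough (potential_quotient g x = q) as -> by easy.
  unfold potential_quotient; destruct (Req_EM_T x 0) as [->|Hx0].
  - rewrite !PSeries_0 in E; destruct Hp as [Hp0 _]; destruct HP as [HP0 _].
    rewrite Hp0, HP0 in E; lra.
  - destruct (Hg x Hx) as [-> ->]; rewrite <- E; field; lra.
Qed.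

(** Locally the coordinate is [x * sqrt (P x)], whose square is twice the potential. Its slope is
    close to 1, so after clamping the slope it extends to a global expanding map, and [h] is the
    inverse of that map. *)
Lemma straightening_exists g p P b e :
  (forall x, continuous g x) ->
  slowly_growing p b -> slowly_growing P b -> 0 < e -> e * b <= 1 / 2 ->
  (forall x, Rabs x < e -> g x = x * PSeries p x /\ potential g x = x ^ 2 / 2 * PSeries P x) ->
  exists X h eta rho, straightening g X h eta rho.
Proof.
  intros Hgc Hp HP He Heb Hg.
  assert (Hb : 0 < b) by apply Hp.
  assert (Hsmall : forall x, Rabs x < e -> Rabs x * b <= 1 / 2).
  { intros x Hx; apply Rle_trans with (2 := Heb), Rmult_le_compat_r; lra. }
  assert (Bp : forall x, Rabs x < e -> 3 / 4 <= PSeries p x <= 5 / 4).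
  { intros x Hx; pose proof (slowly_growing_near_1 _ _ _ Hp (Hsmall x Hx)) as H.
    apply Rabs_le_between in H; lra. }
  assert (BP : forall x, Rabs x < e -> 3 / 4 <= PSeries P x <= 5 / 4).
  { intros x Hx; pose proof (slowly_growing_near_1 _ _ _ HP (Hsmall x Hx)) as H.
    apply Rabs_le_between in H; lra. }
  assert (Bs : forall x, Rabs x < e -> 3 / 4 <= sqrt (PSeries P x) <= 5 / 4).
  { intros x Hx; specialize (BP x Hx).
    pose proof (sqrt_sqrt (PSeries P x) ltac:(lra)); pose proof (sqrt_pos (PSeries P x)).
    nra. }
  assert (Gp : forall x, Rabs x < e -> is_derive (PSeries p) x (PSeries (PS_derive p) x)).
  { intros x Hx; apply PSeries_is_derive_geometric with 1 b;
      [easy | apply slowly_growing_geometric; easy | specialize (Hsmall x Hx); lra]. }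
  assert (GP : forall x, Rabs x < e -> is_derive (PSeries P) x (PSeries (PS_derive P) x)).
  { intros x Hx; apply PSeries_is_derive_geometric with 1 b;
      [easy | apply slowly_growing_geometric; easy | specialize (Hsmall x Hx); lra]. }
  (* The derivative of the potential is the force; in normal form both sides carry a factor [x]. At
     the origin the identity compares constant terms. *)
  assert (EP : forall x, Rabs x < e ->
    PSeries P x + x * PSeries (PS_derive P) x / 2 = PSeries p x).
  { intros x Hx; destruct (Req_dec x 0) as [->|Hx0].
    - rewrite !PSeries_0; destruct Hp as [-> _]; destruct HP as [-> _]; lra.
    - assert (Hd : is_derive (potential g) x
        (x * PSeries P x + x ^ 2 / 2 * PSeries (PS_derive P) x)).
      { apply is_derive_ext_loc with (fun x => x ^ 2 / 2 * PSeries P x).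
        - assert (Hr : 0 < e - Rabs x) by lra.
          exists (mkposreal _ Hr); intros y Hy.
          change (Rabs (y - x) < e - Rabs x) in Hy.
          symmetry; apply Hg; pose proof (Rabs_triang_inv y x); lra.
        - pose proof (GP x Hx) as HGP.
          auto_derive; [exists (PSeries (PS_derive P) x); exact HGP|].
          replace (Derive _ x) with (PSeries (PS_derive P) x)
            by (symmetry; exact (is_derive_unique _ _ _ HGP)); field. }
      pose proof (is_derive_RInt_continuous g x Hgc) as Hd'.
      apply is_derive_unique in Hd; apply is_derive_unique in Hd'.
      change (RInt g 0) with (potential g) in Hd'.
      rewrite Hd in Hd'; destruct (Hg x Hx) as [Hgx _]; rewrite Hgx in Hd'.
      apply Rmult_eq_reg_l with x; [|easy]; lra. }
  set (X0 := fun x => x * sqrt (PSeries P x)).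
  set (D0 := fun x => PSeries p x / sqrt (PSeries P x)).
  assert (HX0 : forall x, Rabs x < e -> is_derive X0 x (D0 x)).
  { intros x Hx; unfold X0, D0.
    pose proof (is_derive_sqrt _ _ _ (GP x Hx) ltac:(specialize (BP x Hx); lra)) as Hs.
    pose proof (is_derive_mult (K := R_AbsRing) _ _ x _ _ (is_derive_id x) Hs
      (fun n m => Rmult_comm n m)) as Hm.
    eapply is_derive_ext; [|replace (_ / _) with (plus (mult one (sqrt (PSeries P x)))
      (mult x (PSeries (PS_derive P) x / (2 * sqrt (PSeries P x))))); [exact Hm|]].
    - intros t; easy.
    - rewrite <- (EP x Hx); unfold plus, mult, one; simpl.
      specialize (Bs x Hx); specialize (BP x Hx).
      set (s := sqrt (PSeries P x)) in *.
      assert (Hss : s * s = PSeries P x) by (apply sqrt_sqrt; lra).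
      rewrite <- Hss; field; lra. }
  assert (HD0 : forall x, Rabs x < e -> continuous D0 x).
  { intros x Hx; apply (continuous_mult (K := R_AbsRing) (PSeries p)).
    - exact (is_derive_continuous _ _ _ (Gp x Hx)).
    - apply continuous_Rinv_comp; [|specialize (Bs x Hx); lra].
      apply continuous_sqrt_comp; exact (is_derive_continuous _ _ _ (GP x Hx)). }
  assert (BD0 : forall x, Rabs x < e -> 1 / 2 <= D0 x <= 2).
  { intros x Hx; specialize (Bs x Hx); specialize (Bp x Hx); unfold D0.
    split; apply Rmult_le_reg_r with (sqrt (PSeries P x)); try lra;
      field_simplify; lra. }
  (* Agrees with [D0] up to [e / 2] and keeps its bounds everywhere. *)
  set (D := fun x => D0 (clamp (e / 2) x)).
  assert (Hcl : forall x, Rabs (clamp (e / 2) x) < e).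
  { intros x; pose proof (clamp_bound (e / 2) x); lra. }
  assert (HD : forall x, continuous D x).
  { intros x; apply (continuous_comp (clamp (e / 2)) D0); [apply clamp_continuous; lra|].
    apply HD0, Hcl. }
  set (X := RInt D 0).
  assert (HX : forall x, is_derive X x (D x)) by (intros; apply is_derive_RInt_continuous, HD).
  assert (HXX0 : forall x, Rabs x < e / 2 -> X x = X0 x).
  { intros x Hx.
    assert (HX00 : X 0 - X0 0 = 0).
    { unfold X, X0; rewrite RInt_point; unfold zero; simpl; ring. }
    enough (X 0 - X0 0 = X x - X0 x) by lra.
    apply (derive_zero_constant (fun t => X t - X0 t)).
    intros t Ht.
    assert (Hte : Rabs t < e / 2).
    { revert Hx Ht; unfold Rmin, Rmax, Rabs.
      repeat destruct Rle_dec; repeat destruct Rcase_abs; lra. }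
    pose proof (is_derive_minus (V := R_NormedModule) _ _ t _ _ (HX t) (HX0 t ltac:(lra))) as H.
    unfold D in H; rewrite clamp_id, minus_eq_zero in H by lra; exact H. }
  destruct (expanding_inverse X D (1 / 2)) as (h & HXh & HhX & Hh); [lra | easy | |].
  { intros x; apply BD0, Hcl. }
  assert (Hh0 : h 0 = 0).
  { replace 0 with (X 0) at 1; [apply HhX|].
    unfold X; rewrite RInt_point; easy. }
  assert (Hhb : forall u, Rabs (h u) <= 2 * Rabs u).
  { intros u; destruct (mean_value h (fun u => / D (h u)) 0 u) as (c & _ & Hc).
    - intros; apply Hh.
    - rewrite Hh0, !Rminus_0_r in Hc; rewrite Hc, Rabs_mult.
      apply Rmult_le_compat_r; [apply Rabs_pos|].
      pose proof (BD0 _ (Hcl (h c))) as Hbd; fold (D (h c)) in Hbd.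
      rewrite Rabs_pos_eq by (left; apply Rinv_0_lt_compat; lra).
      apply Rmult_le_reg_r with (D (h c)); [lra|]; rewrite Rinv_l; lra. }
  (* Since [h] at most doubles distances to the origin, [Rabs u < e / 4] keeps [h u] where the clamp
     is the identity. *)
  exists X, h, (fun u => / D (h u)), (e / 4).
  assert (Hin : forall u, Rabs u < e / 4 -> Rabs (h u) < e / 2).
  { intros u Hu; specialize (Hhb u); lra. }
  assert (Hloc : forall u, Rabs u < e / 4 ->
    u = h u * sqrt (PSeries P (h u)) /\
    / D (h u) = sqrt (PSeries P (h u)) / PSeries p (h u)).
  { intros u Hu; specialize (Hin u Hu); split.
    - rewrite <- (HXh u) at 1; apply HXX0; easy.
    - unfold D; rewrite clamp_id by lra; unfold D0.
      specialize (Bs (h u) ltac:(lra)); specialize (Bp (h u) ltac:(lra)); field; lra. }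
  split; try easy.
  - lra.
  - intros x; exact (is_derive_continuous _ _ _ (HX x)).
  - intros u; apply continuous_Rinv_comp.
    + apply (continuous_comp h D); [exact (is_derive_continuous _ _ _ (Hh u)) | apply HD].
    + pose proof (BD0 _ (Hcl (h u))) as Hbd; fold (D (h u)) in Hbd; lra.
  - intros u; pose proof (BD0 _ (Hcl (h u))) as Hbd; fold (D (h u)) in Hbd.
    apply Rmult_le_reg_r with (D (h u)); [lra|]; rewrite Rinv_l; lra.
  - intros u Hu; specialize (Hin u Hu).
    destruct (Hloc u Hu) as [Eu ->]; rewrite Eu at 4.
    destruct (Hg (h u) ltac:(lra)) as [-> _].
    specialize (Bp (h u) ltac:(lra)); field; lra.
  - intros u Hu; specialize (Hin u Hu).
    destruct (Hloc u Hu) as [Eu _]; rewrite Eu at 2.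
    destruct (Hg (h u) ltac:(lra)) as [_ ->].
    specialize (BP (h u) ltac:(lra)).
    rewrite Rpow_mult_distr, pow2_sqrt by lra; field.
  - intros u Hu; specialize (Hin u Hu).
    destruct (Hloc u Hu) as [_ ->].
    destruct (potential_quotient_PSeries g p P b e Hp HP Heb Hg) as (q & _ & Hq).
    destruct (Hq (h u) ltac:(lra)) as [_ Hq2].
    specialize (BP (h u) ltac:(lra)); specialize (Bp (h u) ltac:(lra)).
    unfold Rdiv; rewrite Rpow_mult_distr, pow2_sqrt by lra.
    rewrite <- Hq2; field; lra.
Qed.

(** * Orbits and their periods *)

Lemma is_derive_comp_R (f k : R -> R) x df dk :
  is_derive f (k x) df -> is_derive k x dk -> is_derive (fun t => f (k t)) x (dk * df).
Proof. exact (is_derive_comp (K := R_AbsRing) (V := R_NormedModule) f k x df dk). Qed.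

Lemma ex_RInt_continuous_R (f : R -> R) a b :
  (forall x, continuous f x) -> ex_RInt f a b.
Proof. intros H; apply (ex_RInt_continuous (V := R_CompleteNormedModule)); auto. Qed.

Lemma continuous_scaled_sin (f : R -> R) r s :
  (forall x, continuous f x) -> continuous (fun s => f (r * sin s)) s.
Proof.
  intros Hf; apply (continuous_comp (fun s => r * sin s) f); [|apply Hf].
  apply (ex_derive_continuous (V := R_NormedModule)); auto_derive; easy.
Qed.

Definition orbit_period (eta : R -> R) (r : R) : R :=
  RInt (fun s => eta (r * sin s)) 0 (2 * PI).

(** Shifting the second half turn back by [PI] changes the sign of the sine, which pairs [eta] at
    opposite points. *)
Lemma orbit_period_even_part eta r :
  (forall u, continuous eta u) ->
  orbit_period eta r = RInt (fun s => eta (r * sin s) + eta (- (r * sin s))) 0 PI.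
Proof.
  intros Heta; unfold orbit_period.
  set (w := fun s => eta (r * sin s)).
  assert (Hw : forall s, continuous w s) by (intros; apply continuous_scaled_sin, Heta).
  assert (Hshift : RInt (fun s => eta (- (r * sin s))) 0 PI = RInt w PI (2 * PI)).
  { pose proof (RInt_comp_lin (V := R_CompleteNormedModule) w 1 PI 0 PI
      (ex_RInt_continuous_R _ _ _ Hw)) as H.
    replace (1 * 0 + PI) with PI in H by ring.
    replace (1 * PI + PI) with (2 * PI) in H by ring.
    rewrite <- H; apply RInt_ext; intros s _.
    unfold scal; simpl; unfold mult; simpl; unfold w.
    rewrite Rmult_1_l, Rmult_1_l, neg_sin, Ropp_mult_distr_r; easy. }
  rewrite (RInt_plus (V := R_CompleteNormedModule) (fun s => eta (r * sin s))
    (fun s => eta (- (r * sin s)))).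
  - rewrite Hshift; symmetry; apply (RInt_Chasles (V := R_CompleteNormedModule));
      apply ex_RInt_continuous_R, Hw.
  - apply ex_RInt_continuous_R, Hw.
  - apply ex_RInt_continuous_R; intros s.
    apply continuous_ext with (fun s => eta (- r * sin s));
      [intros; f_equal; ring | apply continuous_scaled_sin, Heta].
Qed.

(** The time as a function of the angle has slope at least [1 / 2], so it can be inverted; the
    resulting angle parametrizes the circle, and [g (h u) * eta u = u] turns this motion into a
    solution. *)
Lemma straightening_orbit g X h eta rho r theta :
  straightening g X h eta rho -> 0 < r < rho ->
  exists x y, solution g x y /\ x 0 = h (r * sin theta) /\ y 0 = r * cos theta /\
    minimal_period x y (orbit_period eta r).
Proof.
  intros St Hr.
  set (w := fun s => eta (r * sin s)).
  assert (Hw : forall s, continuous w s)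
    by (intros; apply continuous_scaled_sin, (str_eta_cont _ _ _ _ _ St)).
  assert (Hwl : forall s, 1 / 2 <= w s) by (intros s; exact (str_eta_lower _ _ _ _ _ St _)).
  (* [tau a] is the time needed to turn by the angle [a] along the orbit. *)
  set (tau := RInt w 0).
  assert (Htau : forall s, is_derive tau s (w s)) by (intros s; apply is_derive_RInt_continuous; exact Hw).
  assert (Htau0 : tau 0 = 0) by (unfold tau; rewrite RInt_point; easy).
  (* The speed [w] has period [2 * PI], so the time of a full turn does not depend on the starting
     angle. *)
  assert (Hturn : forall a, tau (a + 2 * PI) = tau a + orbit_period eta r).
  { intros a.
    enough (tau (a + 2 * PI) - tau a = tau (0 + 2 * PI) - tau 0) as H.
    { rewrite Rplus_0_l, Htau0 in H; change (orbit_period eta r) with (tau (2 * PI)); lra. }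
    apply (derive_zero_constant (fun a => tau (a + 2 * PI) - tau a)).
    intros s _.
    assert (H : is_derive (fun a => tau (a + 2 * PI)) s (1 * w (s + 2 * PI))).
    { apply (is_derive_comp_R tau (fun a => a + 2 * PI)); [apply Htau | auto_derive; [easy | ring]]. }
    pose proof (is_derive_minus (V := R_NormedModule) _ _ s _ _ H (Htau s)) as H'.
    replace 0 with (minus (1 * w (s + 2 * PI)) (w s)); [exact H'|].
    unfold w; rewrite sin_plus, cos_2PI, sin_2PI.
    unfold minus, plus, opp; simpl.
    replace (sin s * 1 + cos s * 0) with (sin s) by ring; ring. }
  destruct (expanding_inverse tau w (1 / 2)) as (k & Htk & Hkt & Hk); [lra | easy..|].
  set (ang := fun t => k (t + tau theta)).
  assert (Hang : forall t, is_derive ang t (/ w (ang t))).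
  { intros t; rewrite <- (Rmult_1_l (/ _)).
    apply (is_derive_comp_R k (fun t => t + tau theta)); [apply Hk | auto_derive; [easy | ring]]. }
  assert (Hang0 : ang 0 = theta) by (unfold ang; rewrite Rplus_0_l; apply Hkt).
  assert (Htang : forall t, tau (ang t) = t + tau theta) by (intros; apply Htk).
  assert (Hu : forall s, Rabs (r * sin s) < rho).
  { intros s; rewrite Rabs_mult, Rabs_pos_eq by lra.
    assert (Rabs (sin s) <= 1) by (apply Rabs_le, SIN_bound).
    pose proof (Rabs_pos (sin s)); nra. }
  exists (fun t => h (r * sin (ang t))), (fun t => r * cos (ang t)).
  split; [|split; [rewrite Hang0; easy | split; [rewrite Hang0; easy|]]].
  - intros t; pose proof (Hwl (ang t)) as Hp; unfold w in Hp.
    split.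
    + assert (Hs : is_derive (fun s => h (r * sin s)) (ang t)
        (r * cos (ang t) * eta (r * sin (ang t)))).
      { apply (is_derive_comp_R h (fun s => r * sin s)).
        - apply (str_h_derive _ _ _ _ _ St).
        - auto_derive; [easy | ring]. }
      pose proof (is_derive_comp_R _ _ t _ _ Hs (Hang t)) as H.
      replace (r * cos (ang t)) with
        (/ w (ang t) * (r * cos (ang t) * eta (r * sin (ang t)))); [exact H|].
      unfold w; field; lra.
    + assert (Hs : is_derive (fun s => r * cos s) (ang t) (- (r * sin (ang t))))
        by (auto_derive; [easy | ring]).
      pose proof (is_derive_comp_R _ _ t _ _ Hs (Hang t)) as H.
      replace (- g (h (r * sin (ang t)))) with (/ w (ang t) * - (r * sin (ang t)));
        [exact H|].
      rewrite <- (str_force _ _ _ _ _ St (r * sin (ang t)) (Hu _)) at 1.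
      unfold w; field; lra.
  - assert (Hincr : forall a b, a <= b -> tau a <= tau b).
    { intros a b Hab; pose proof (derive_lower_bound tau w (1 / 2) a b Htau Hwl Hab); lra. }
    split; [split|].
    + pose proof (derive_lower_bound tau w (1 / 2) 0 (2 * PI) Htau Hwl) as H.
      pose proof PI_RGT_0; specialize (H ltac:(lra)).
      rewrite Htau0 in H; change (orbit_period eta r) with (tau (2 * PI)); lra.
    + intros t.
      assert (Ht : ang (t + orbit_period eta r) = ang t + 2 * PI).
      { rewrite <- (Hkt (ang t + 2 * PI)), Hturn, Htang; unfold ang; f_equal; ring. }
      rewrite Ht, sin_plus, cos_plus, cos_2PI, sin_2PI.
      split; [f_equal|]; ring.
    (* After a period [S] the angle has the same sine and cosine as [theta] but has advanced. An
       advance of at least a full turn takes at least [orbit_period eta r], so only a smaller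
       advance must be excluded. *)
    + intros S [HS Hper]; destruct (Hper 0) as [Hx Hy].
      rewrite Rplus_0_l in Hx, Hy.
      apply (f_equal X) in Hx; rewrite !(str_X_h _ _ _ _ _ St) in Hx.
      apply Rmult_eq_reg_l in Hx; [|lra]; apply Rmult_eq_reg_l in Hy; [|lra].
      pose proof (Htang S) as HtS.
      rewrite Hang0 in *.
      assert (Hpos : theta < ang S).
      { destruct (Rlt_dec theta (ang S)); [easy|].
        pose proof (Hincr (ang S) theta ltac:(lra)); lra. }
      destruct (Rle_dec (theta + 2 * PI) (ang S)) as [Hle|Hlt].
      { apply Hincr in Hle; rewrite Hturn in Hle; lra. }
      exfalso.
      (* The half advance lies strictly between 0 and [PI], so its sine is positive and the cosine
         of the whole advance cannot be 1. *)
      set (d := (ang S - theta) / 2).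
      assert (Hsd : 0 < sin d) by (apply sin_gt_0; unfold d; lra).
      assert (Hcd : cos (2 * d) = 1).
      { replace (2 * d) with (ang S - theta) by (unfold d; field).
        rewrite cos_minus, Hx, Hy; pose proof (sin2_cos2 theta); unfold Rsqr in *; lra. }
      rewrite cos_2a_sin in Hcd; nra.
Qed.

(** * Uniqueness, energy and confinement of solutions *)

(** [D t * exp (- K * t)] cannot increase forwards in time and [D t * exp (K * t)] cannot increase
    backwards; both start at zero. *)
Lemma gronwall_zero (D dD : R -> R) K :
  (forall t, is_derive D t (dD t)) -> (forall t, 0 <= D t) ->
  (forall t, Rabs (dD t) <= K * D t) -> D 0 = 0 -> forall t, D t = 0.
Proof.
  intros HD Hpos Hle H0 t.
  assert (Hd : forall c s, is_derive (fun s => D s * exp (c * s)) s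
    ((dD s + c * D s) * exp (c * s))).
  { intros c s; pose proof (HD s) as Hs.
    auto_derive; [exists (dD s); exact Hs|].
    replace (Derive _ s) with (dD s) by (symmetry; exact (is_derive_unique _ _ _ Hs)); ring. }
  apply Rle_antisym; [|apply Hpos].
  destruct (Rle_dec 0 t) as [Ht|Ht].
  - destruct (mean_value _ _ 0 t (fun s _ => Hd (- K) s)) as (c & _ & Hc).
    rewrite H0 in Hc; specialize (Hle c); apply Rabs_le_between in Hle.
    pose proof (exp_pos (- K * c)); pose proof (exp_pos (- K * t)).
    assert ((dD c + - K * D c) * exp (- K * c) <= 0) by nra.
    assert (D t * exp (- K * t) <= 0) by nra.
    nra.
  - destruct (mean_value _ _ 0 t (fun s _ => Hd K s)) as (c & _ & Hc).
    rewrite H0 in Hc; specialize (Hle c); apply Rabs_le_between in Hle.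
    pose proof (exp_pos (K * c)); pose proof (exp_pos (K * t)).
    assert (0 <= (dD c + K * D c) * exp (K * c)) by nra.
    assert (D t * exp (K * t) <= 0) by nra.
    nra.
Qed.

Lemma solution_unique g L e x y x' y' :
  (forall a b, Rabs a < e -> Rabs b < e -> Rabs (g a - g b) <= L * Rabs (a - b)) ->
  0 <= L -> solution g x y -> solution g x' y' ->
  (forall t, Rabs (x t) < e) -> (forall t, Rabs (x' t) < e) ->
  x 0 = x' 0 -> y 0 = y' 0 -> forall t, x t = x' t /\ y t = y' t.
Proof.
  intros HL HL0 Hs Hs' He He' Hx0 Hy0.
  set (D := fun t => (x t - x' t) ^ 2 + (y t - y' t) ^ 2).
  enough (forall t, D t = 0) as H0.
  { intros t; specialize (H0 t); unfold D in H0.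
    pose proof (pow2_ge_0 (x t - x' t)); pose proof (pow2_ge_0 (y t - y' t)).
    split; apply Rminus_diag_uniq, Rsqr_0_uniq; unfold Rsqr; nra. }
  apply gronwall_zero with (K := 1 + L) (dD := fun t =>
    2 * (x t - x' t) * (y t - y' t) + 2 * (y t - y' t) * (- g (x t) + g (x' t))).
  - intros t; destruct (Hs t) as [H1 H2]; destruct (Hs' t) as [H3 H4]; unfold D.
    auto_derive; [repeat split; eexists; eassumption|].
    replace (Derive (fun t => x t) t) with (y t) by (symmetry; exact (is_derive_unique _ _ _ H1)).
    replace (Derive (fun t => x' t) t) with (y' t) by (symmetry; exact (is_derive_unique _ _ _ H3)).
    replace (Derive (fun t => y t) t) with (- g (x t)) by (symmetry; exact (is_derive_unique _ _ _ H2)).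
    replace (Derive (fun t => y' t) t) with (- g (x' t)) by (symmetry; exact (is_derive_unique _ _ _ H4)).
    ring.
  - intros t; unfold D; pose proof (pow2_ge_0 (x t - x' t)); pose proof (pow2_ge_0 (y t - y' t)); lra.
  - intros t; unfold D.
    specialize (HL _ _ (He t) (He' t)).
    rewrite <- (pow2_abs (x t - x' t)), <- (pow2_abs (y t - y' t)).
    eapply Rle_trans; [apply Rabs_triang|].
    rewrite !Rabs_mult, (Rabs_pos_eq 2) by lra.
    replace (- g (x t) + g (x' t)) with (- (g (x t) - g (x' t))) by ring.
    rewrite Rabs_Ropp.
    pose proof (Rabs_pos (x t - x' t)) as Ha; pose proof (Rabs_pos (y t - y' t)) as Hb.
    set (a := Rabs (x t - x' t)) in *; set (b := Rabs (y t - y' t)) in *.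
    assert (2 * b * Rabs (g (x t) - g (x' t)) <= 2 * b * (L * a)).
    { apply Rmult_le_compat_l; lra. }
    (* This is [2 * a * b <= a ^ 2 + b ^ 2], scaled to bound the mixed terms by the squared
       distance. *)
    assert (0 <= (1 + L) * (a - b) ^ 2).
    { apply Rmult_le_pos; [lra | apply pow2_ge_0]. }
    nra.
  - unfold D; rewrite Hx0, Hy0; ring.
Qed.

Lemma solution_energy g x y t :
  (forall z, continuous g z) -> solution g x y ->
  y t ^ 2 / 2 + potential g (x t) = y 0 ^ 2 / 2 + potential g (x 0).
Proof.
  intros Hg Hs.
  apply (derive_zero_constant (fun t => y t ^ 2 / 2 + potential g (x t))).
  intros s _; destruct (Hs s) as [H1 H2].
  pose proof (is_derive_comp_R _ _ s _ _ (is_derive_RInt_continuous g (x s) Hg) H1) as H3.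
  assert (H4 : is_derive (fun t => y t ^ 2 / 2) s (y s * - g (x s))).
  { auto_derive; [eexists; exact H2|].
    replace (Derive _ s) with (- g (x s)) by (symmetry; exact (is_derive_unique _ _ _ H2)); field. }
  pose proof (is_derive_plus (V := R_NormedModule) _ _ s _ _ H4 H3) as H.
  replace 0 with (plus (y s * - g (x s)) (y s * g (x s))); [exact H|].
  unfold plus; simpl; ring.
Qed.

(** Inside the straightened region twice the energy is [X ^ 2 + y ^ 2]. A solution that escapes
    would meet [Rabs X = r] by continuity, with more energy than it started with. *)
Lemma solution_confined g X h eta rho r x y :
  (forall z, continuous g z) -> straightening g X h eta rho -> 0 < r < rho ->
  solution g x y -> X (x 0) ^ 2 + y 0 ^ 2 < r ^ 2 -> forall t, Rabs (X (x t)) < r.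
Proof.
  intros Hg St Hr Hs H0 t.
  assert (HG : forall s, Rabs (X (x s)) < rho -> potential g (x s) = X (x s) ^ 2 / 2).
  { intros s Hs'; rewrite <- (str_h_X _ _ _ _ _ St (x s)) at 1.
    apply (str_potential _ _ _ _ _ St); easy. }
  pose proof (pow2_ge_0 (y 0)) as Hy0.
  assert (HX0 : Rabs (X (x 0)) < r).
  { rewrite <- (Rabs_pos_eq r) by lra.
    apply Rsqr_lt_abs_0; unfold Rsqr; nra. }
  destruct (Rlt_dec (Rabs (X (x t))) r) as [|Hge]; [easy | exfalso].
  destruct (IVT_gen_consistent (fun s => Rabs (X (x s))) 0 t r) as (s & _ & Hsr).
  - intros s; apply continuous_Rabs_comp, (continuous_comp x X).
    + exact (is_derive_continuous _ _ _ (proj1 (Hs s))).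
    + apply (str_X_cont _ _ _ _ _ St).
  - rewrite Rmin_left, Rmax_right; lra.
  - pose proof (solution_energy g x y s Hg Hs) as HE.
    rewrite (HG s), (HG 0), <- (pow2_abs (X (x s))), Hsr in HE by lra.
    pose proof (pow2_ge_0 (y s)); lra.
Qed.

(** The angle is measured from the [y] axis, as in the orbits above; [acos] covers the half plane
    [0 <= a] and its negative the other one. *)
Lemma polar_coordinates a b : 0 < a ^ 2 + b ^ 2 ->
  exists r theta, 0 < r /\ r ^ 2 = a ^ 2 + b ^ 2 /\ a = r * sin theta /\ b = r * cos theta.
Proof.
  intros Hab; set (r := sqrt (a ^ 2 + b ^ 2)).
  assert (Hr : 0 < r) by (apply sqrt_lt_R0; easy).
  assert (Hr2 : r ^ 2 = a ^ 2 + b ^ 2) by (apply pow2_sqrt; lra).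
  assert (Hcos : -1 <= b / r <= 1).
  { pose proof (pow2_ge_0 a).
    split; apply Rmult_le_reg_r with r; try easy; unfold Rdiv;
      rewrite Rmult_assoc, Rinv_l, Rmult_1_r by lra; nra. }
  assert (Hsin : sin (acos (b / r)) = Rabs a / r).
  { rewrite sin_acos by easy.
    replace (1 - (b / r)²) with ((Rabs a / r) ^ 2).
    - rewrite sqrt_pow2; [easy|].
      apply Rmult_le_pos; [apply Rabs_pos | left; apply Rinv_0_lt_compat; easy].
    - unfold Rsqr, Rdiv; rewrite Rpow_mult_distr, pow2_abs.
      replace (a ^ 2) with (r ^ 2 - b ^ 2) by lra; field; lra. }
  destruct (Rle_dec 0 a) as [Ha|Ha].
  - exists r, (acos (b / r)); rewrite Hsin, cos_acos, Rabs_pos_eq by easy.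
    repeat split; [easy | easy | field; lra | field; lra].
  - exists r, (- acos (b / r)).
    rewrite sin_neg, cos_neg, Hsin, cos_acos, Rabs_left by lra.
    repeat split; [easy | easy | field; lra | field; lra].
Qed.

(** * The two implications *)

(** Differentiating [eta ^ 2 = 2 * potential_quotient g (h u)] gives a factor [eta] on both sides,
    because [h] has derivative [eta]; it cancels and leaves the derivative in [x]. *)
Lemma straightening_eta_derive g X h eta rho u l :
  straightening g X h eta rho -> Rabs u < rho ->
  is_derive (potential_quotient g) (h u) l -> is_derive eta u l.
Proof.
  intros St Hu Hl.
  assert (Heta : forall v, 0 < eta v).
  { intros v; pose proof (str_eta_lower _ _ _ _ _ St v); lra. }
  assert (Hsq : forall v, Rabs v < rho -> 2 * potential_quotient g (h v) = eta v ^ 2).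
  { intros v Hv; symmetry; apply (str_quotient _ _ _ _ _ St); easy. }
  pose proof (is_derive_comp_R _ _ u _ _ Hl (str_h_derive _ _ _ _ _ St u)) as H1.
  pose proof (is_derive_scal _ u 2 _ H1) as H2; simpl in H2.
  apply is_derive_sqrt in H2; [|rewrite Hsq by easy; apply pow_lt, Heta].
  rewrite Hsq, sqrt_pow2 in H2 by (try easy; left; apply Heta).
  replace l with (2 * (eta u * l) / (2 * eta u)) by (specialize (Heta u); field; lra).
  apply is_derive_ext_loc with (2 := H2).
  assert (Hr : 0 < rho - Rabs u) by lra.
  exists (mkposreal _ Hr); intros v Hv.
  change (Rabs (v - u) < rho - Rabs u) in Hv.
  rewrite Hsq, sqrt_pow2; [easy | left; apply Heta |].
  pose proof (Rabs_triang_inv v u); lra.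
Qed.

Lemma is_derive_reflect (f : R -> R) u l :
  is_derive f (- u) l -> is_derive (fun v => f (- v)) u (- l).
Proof.
  intros H; replace (- l) with (-1 * l) by ring.
  apply (is_derive_comp_R f Ropp); [exact H | auto_derive; [easy | ring]].
Qed.

Lemma is_derive_even_part (f : R -> R) u l l' :
  is_derive f u l -> is_derive f (- u) l' ->
  is_derive (fun v => f v + f (- v)) u (l - l').
Proof.
  intros H H'.
  exact (is_derive_plus (V := R_NormedModule) _ _ u _ _ H (is_derive_reflect _ _ _ H')).
Qed.

Lemma solution_0 g x y L e :
  (forall a b, Rabs a < e -> Rabs b < e -> Rabs (g a - g b) <= L * Rabs (a - b)) ->
  0 <= L -> 0 < e -> g 0 = 0 -> solution g x y -> (forall t, Rabs (x t) < e) ->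
  x 0 = 0 -> y 0 = 0 -> forall t, x t = 0 /\ y t = 0.
Proof.
  intros HL HL0 He g0 Hs Hx Hx0 Hy0.
  apply (solution_unique g L e x y (fun _ => 0) (fun _ => 0)); try easy.
  - intros t; split; [apply (is_derive_const (V := R_NormedModule))|].
    rewrite g0, Ropp_0; apply (is_derive_const (V := R_NormedModule)).
  - intros _; rewrite Rabs_R0; easy.
Qed.

(** The explicit orbits have period [2 * PI]. Isochronicity concerns arbitrary solutions, so these
    are confined to a region where [g] is Lipschitz and identified with the explicit ones by
    uniqueness. *)
Lemma isochronous_of_even_part g X h eta rho d :
  (forall z, continuous g z) -> analytic_at g 0 -> g 0 = 0 ->
  straightening g X h eta rho -> 0 < d ->
  (forall u, Rabs u < d -> eta u + eta (- u) = 2) ->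
  isochronous_center_at_origin g.
Proof.
  intros Hgc Hga g0 St Hd Heven.
  destruct (analytic_at_lipschitz g 0 Hga) as (e & L & He & HL0 & HL').
  assert (HL : forall a b, Rabs a < e -> Rabs b < e ->
    Rabs (g a - g b) <= L * Rabs (a - b)).
  { intros a b Ha Hb; apply HL'; rewrite Rminus_0_r; easy. }
  pose proof (str_rho _ _ _ _ _ St) as Hrho.
  (* The three terms serve the even part, the straightening, and the Lipschitz bound, the last
     because [h] at most doubles distances to the origin. *)
  set (r0 := Rmin (Rmin d (rho / 2)) (e / 2)).
  assert (Hr0 : 0 < r0 /\ r0 <= d /\ r0 < rho /\ 2 * r0 <= e).
  { unfold r0, Rmin; repeat destruct Rle_dec; lra. }
  assert (HX0 : X 0 = 0).
  { rewrite <- (str_h_0 _ _ _ _ _ St) at 1; apply (str_X_h _ _ _ _ _ St). }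
  assert (Hnear : locally ((0, 0) : R * R) (fun p => X (fst p) ^ 2 + snd p ^ 2 < r0 ^ 2)).
  { assert (Hr2 : 0 < r0 / 2) by lra.
    destruct (str_X_cont _ _ _ _ _ St 0
      (fun z => Rabs z < r0 / 2)) as [a Ha].
    { exists (mkposreal _ Hr2); intros z Hz.
      change (Rabs (z - X 0) < r0 / 2) in Hz; rewrite HX0, Rminus_0_r in Hz; easy. }
    assert (Hm : 0 < Rmin a (r0 / 2)) by (apply Rmin_pos; [apply cond_pos | easy]).
    exists (mkposreal _ Hm); intros [p1 p2] [H1 H2]; simpl in *.
    assert (B1 : Rabs (X p1) < r0 / 2).
    { apply Ha; change (Rabs (p1 - 0) < Rmin a (r0 / 2)) in H1.
      change (Rabs (p1 - 0) < a); apply Rlt_le_trans with (1 := H1), Rmin_l. }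
    assert (B2 : Rabs p2 < r0 / 2).
    { change (Rabs (p2 - 0) < Rmin a (r0 / 2)) in H2; rewrite Rminus_0_r in H2.
      apply Rlt_le_trans with (1 := H2), Rmin_r. }
    apply Rabs_def2 in B1; apply Rabs_def2 in B2; nra. }
  assert (Horbit : forall p, p <> (0, 0) -> X (fst p) ^ 2 + snd p ^ 2 < r0 ^ 2 ->
    exists x y, solution g x y /\ (x 0, y 0) = p /\ minimal_period x y (2 * PI)).
  { intros [p1 p2] Hp Hsmall; simpl in Hsmall.
    destruct (polar_coordinates (X p1) p2) as (r & theta & Hr & Hr2 & E1 & E2).
    { destruct (Req_dec p2 0) as [->|Hp2]; [|pose proof (pow2_ge_0 (X p1));
        pose proof (pow2_gt_0 p2 Hp2); lra].
      assert (HXp : X p1 <> 0).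
      { intros H; apply Hp; f_equal.
        rewrite <- (str_h_X _ _ _ _ _ St p1), H; apply (str_h_0 _ _ _ _ _ St). }
      pose proof (pow2_gt_0 _ HXp); lra. }
    assert (Hrr : r < r0) by nra.
    destruct (straightening_orbit g X h eta rho r theta St ltac:(lra))
      as (x & y & Hs & Hx & Hy & Hmin).
    exists x, y; split; [easy | split].
    - rewrite Hx, Hy, <- E1, <- E2, (str_h_X _ _ _ _ _ St); easy.
    - replace (2 * PI) with (orbit_period eta r); [easy|].
      rewrite orbit_period_even_part by apply (str_eta_cont _ _ _ _ _ St).
      rewrite (RInt_ext _ (fun _ => 2)).
      + rewrite RInt_const; unfold scal; simpl; unfold mult; simpl; ring.
      + intros s _; apply Heven.
        rewrite Rabs_mult, (Rabs_pos_eq r) by lra.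
        assert (Rabs (sin s) <= 1) by (apply Rabs_le, SIN_bound).
        pose proof (Rabs_pos (sin s)); nra. }
  assert (Hconf : forall x y, solution g x y -> X (x 0) ^ 2 + y 0 ^ 2 < r0 ^ 2 ->
    forall t, Rabs (x t) < e).
  { intros x y Hs H0 t.
    pose proof (solution_confined g X h eta rho r0 x y Hgc St ltac:(lra) Hs H0 t) as Ht.
    rewrite <- (str_h_X _ _ _ _ _ St (x t)).
    pose proof (str_h_bound _ _ _ _ _ St (X (x t))); lra. }
  split.
  - apply filter_imp with (2 := Hnear); intros p Hsmall Hp.
    destruct (Horbit p Hp Hsmall) as (x & y & H); exists x, y, (2 * PI); exact H.
  - exists (2 * PI); apply filter_imp with (2 := Hnear).
    intros [p1 p2] Hsmall x y S Hs Hxy [[HS0 HS] HSmin].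
    injection Hxy as Hx Hy.
    assert (Hsx : X (x 0) ^ 2 + y 0 ^ 2 < r0 ^ 2) by (rewrite Hx, Hy; exact Hsmall).
    destruct (excluded_middle_informative ((p1, p2) = (0, 0))) as [H0|Hp].
    (* The solution through the origin is constant, so half of a period is again a period and none
       is minimal. *)
    + injection H0 as -> ->.
      pose proof (solution_0 g x y L e HL HL0 He g0 Hs (Hconf x y Hs Hsx) Hx Hy) as Hz.
      assert (Hhalf : period x y (S / 2)).
      { split; [lra|]; intros t.
        destruct (Hz (t + S / 2)) as [-> ->]; destruct (Hz t) as [-> ->]; easy. }
      apply HSmin in Hhalf; lra.
    + destruct (Horbit _ Hp Hsmall) as (x' & y' & Hs' & Hxy' & [HT HTmin]).
      injection Hxy' as Hx' Hy'.
      assert (Heq : forall t, x t = x' t /\ y t = y' t).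
      { apply (solution_unique g L e); try easy; try congruence.
        - apply (Hconf x y); easy.
        - apply (Hconf x' y'); [easy|]; rewrite Hx', Hy'; exact Hsmall. }
      apply Rle_antisym.
      * apply HSmin; split; [apply HT|]; intros t.
        destruct (Heq (t + 2 * PI)) as [-> ->]; destruct (Heq t) as [-> ->]; apply HT.
      * apply HTmin; split; [easy|]; intros t.
        destruct (Heq (t + S)) as [<- <-]; destruct (Heq t) as [<- <-]; apply HS.
Qed.

(** * From a constant period to the series in the potential *)

Lemma orbit_period_constant g X h eta rho :
  straightening g X h eta rho -> isochronous_center_at_origin g ->
  exists T d, 0 < d /\ forall r, 0 < r < d -> orbit_period eta r = T.
Proof.
  intros St [_ [T [e HT]]].
  pose proof (str_rho _ _ _ _ _ St) as Hrho.
  exists T, (Rmin rho e); split; [apply Rmin_pos; [easy | apply cond_pos]|].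
  intros r [Hr0 Hr].
  pose proof (Rmin_l rho e); pose proof (Rmin_r rho e).
  destruct (straightening_orbit g X h eta rho r 0 St ltac:(lra)) as (x & y & Hs & Hx & Hy & Hmin).
  rewrite sin_0, Rmult_0_r, (str_h_0 _ _ _ _ _ St) in Hx; rewrite cos_0, Rmult_1_r in Hy.
  apply (HT (0, r)) with (x := x) (y := y); [|easy | congruence | easy].
  split; simpl.
  - apply ball_center.
  - change (Rabs (r - 0) < e); rewrite Rminus_0_r, Rabs_pos_eq; lra.
Qed.

(** The even part of [eta] has derivative [phi u - phi (- u)]. The sign of [c] covers both
    directions of monotonicity, and on the open half turn the sine is positive, so the integrands
    compare strictly. *)
Lemma orbit_period_not_constant eta phi d r1 r2 c :
  (forall u, continuous eta u) ->
  (forall u, Rabs u < d -> is_derive eta u (phi u)) ->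
  (forall u, 0 < u < d -> 0 < c * (phi u - phi (- u))) ->
  0 < r1 < r2 -> r2 < d -> orbit_period eta r1 <> orbit_period eta r2.
Proof.
  intros Hc Hphi Hpos Hr Hd.
  assert (Hincr : forall a b, 0 < a -> a < b -> b < d ->
    c * (eta a + eta (- a)) < c * (eta b + eta (- b))).
  { intros a b Ha Hab Hb.
    destruct (mean_value (fun u => eta u + eta (- u)) (fun u => phi u - phi (- u)) a b)
      as (z & Hz & E); rewrite ?Rmin_left, ?Rmax_right in * by lra.
    - intros u Hu; apply is_derive_even_part; apply Hphi; rewrite ?Rabs_Ropp, Rabs_pos_eq; lra.
    - specialize (Hpos z ltac:(lra)); nra. }
  rewrite !orbit_period_even_part by easy.
  assert (Hcont : forall r s,
    continuous (fun s => eta (r * sin s) + eta (- (r * sin s))) s).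
  { intros r s; apply (continuous_plus (V := R_NormedModule)).
    - apply continuous_scaled_sin, Hc.
    - apply continuous_ext with (fun s => eta (- r * sin s));
        [intros; f_equal; ring | apply continuous_scaled_sin, Hc]. }
  intros E; apply (f_equal (Rmult c)) in E.
  rewrite <- !(RInt_scal (V := R_CompleteNormedModule)) in E
    by (apply ex_RInt_continuous_R, Hcont).
  apply Rlt_not_eq with (2 := E).
  apply RInt_lt; [apply PI_RGT_0 | | |].
  - intros s _; apply (continuous_scal_r (V := R_NormedModule)), Hcont.
  - intros s _; apply (continuous_scal_r (V := R_NormedModule)), Hcont.
  - intros s Hs; unfold scal; simpl; unfold mult; simpl.
    assert (0 < sin s) by (apply sin_gt_0; lra).
    pose proof (SIN_bound s).
    apply Hincr; nra.
Qed.

Lemma positive_derivative_right (f : R -> R) l :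
  is_derive f 0 l -> 0 < l -> f 0 = 0 ->
  exists d, 0 < d /\ forall u, 0 < u < d -> 0 < f u.
Proof.
  intros Hf Hl H0.
  assert (Hl2 : 0 < l / 2) by lra.
  destruct (is_derive_elim f 0 l Hf (mkposreal _ Hl2)) as (d & Hd & H).
  exists d; split; [easy|]; intros u Hu.
  specialize (H u); rewrite H0, !Rminus_0_r, (Rabs_pos_eq u) in H by lra.
  specialize (H ltac:(lra)); simpl in H; apply Rabs_le_between in H; nra.
Qed.

(* If the odd part of [eta'] vanished to order exactly [2 n + 1], the period
   function would be strictly monotone. *)
Lemma constant_period_vanishing g X h eta rho F T d d' (a : nat -> R) A B n :
  straightening g X h eta rho -> 0 < B -> geometric a A B ->
  0 < d' -> (forall u, Rabs u < d' -> is_derive eta u (F (h u))) ->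
  (forall u, 0 < u < d' -> F (h u) - F (h (- u)) =
     (u ^ 2 / 2) ^ n * (PSeries a (h u) - PSeries a (h (- u)))) ->
  0 < d -> (forall r, 0 < r < d -> orbit_period eta r = T) ->
  a 1%nat = 0.
Proof.
  intros St HB Ha Hd' Heta HF Hd HT.
  destruct (Req_dec (a 1%nat) 0) as [|Ha1]; [easy | exfalso].
  (* The weight [a 1] treats both signs at once: the derivative at 0 is [2 * eta 0 * a 1 ^ 2], which
     is positive. *)
  set (psi := fun u => a 1%nat * (PSeries a (h u) - PSeries a (h (- u)))).
  assert (HaD : is_derive (PSeries a) 0 (a 1%nat)).
  { replace (a 1%nat) with (PSeries (PS_derive a) 0)
      by (rewrite PSeries_0; unfold PS_derive; simpl; ring).
    apply PSeries_is_derive_geometric with A B; [easy..|]; rewrite Rabs_R0; lra. }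
  assert (Hha : is_derive (fun u => PSeries a (h u)) 0 (eta 0 * a 1%nat)).
  { apply is_derive_comp_R; [|apply (str_h_derive _ _ _ _ _ St)].
    rewrite (str_h_0 _ _ _ _ _ St); exact HaD. }
  assert (Hpsi : is_derive psi 0 (a 1%nat * (eta 0 * a 1%nat - - (eta 0 * a 1%nat)))).
  { apply (is_derive_scal (fun u => PSeries a (h u) - PSeries a (h (- u))) 0).
    apply (is_derive_minus (V := R_NormedModule) (fun u => PSeries a (h u))); [exact Hha|].
    apply (is_derive_reflect (fun u => PSeries a (h u))); rewrite Ropp_0; exact Hha. }
  destruct (positive_derivative_right _ _ Hpsi) as (d1 & Hd1 & Hpos).
  { pose proof (str_eta_lower _ _ _ _ _ St 0); pose proof (pow2_gt_0 _ Ha1); nra. }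
  { unfold psi; rewrite Ropp_0; ring. }
  set (m := Rmin (Rmin d d') d1).
  assert (Hm : 0 < m /\ m <= d /\ m <= d' /\ m <= d1).
  { unfold m, Rmin; repeat destruct Rle_dec; lra. }
  apply (orbit_period_not_constant eta (fun u => F (h u)) m (m / 3) (m / 2) (a 1%nat)).
  - apply (str_eta_cont _ _ _ _ _ St).
  - intros u Hu; apply Heta; lra.
  - intros u Hu; rewrite HF by lra.
    replace (a 1%nat * _) with ((u ^ 2 / 2) ^ n * psi u) by (unfold psi; ring).
    apply Rmult_lt_0_compat; [apply pow_lt; nra | apply Hpos; lra].
  - lra.
  - lra.
  - rewrite !HT by lra; easy.
Qed.

(* The coefficients of [(a - a 0 - a 1 x) / (x ^ 2 / 2 * P)]. *)
Definition PS_divide_potential (P a : nat -> R) : nat -> R :=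
  PS_quotient P (fun j => 2 * a (j + 2)%nat).

(** Dropping two coefficients costs [b ^ 2], and the scaling and the division by [P] cost 2 each.
    This constant factor per step bounds the radius of the final series from below. *)
Lemma geometric_divide_potential P a A b :
  slowly_growing P b -> geometric a A b ->
  geometric (PS_divide_potential P a) (A * (4 * b ^ 2)) b.
Proof.
  intros HP Ha.
  replace (A * (4 * b ^ 2)) with (2 * (Rabs 2 * (A * b ^ 2)))
    by (rewrite Rabs_pos_eq by lra; ring).
  apply geometric_quotient; [easy|].
  apply (geometric_scal (fun j => a (j + 2)%nat)), geometric_shift, Ha.
Qed.

Lemma PSeries_divide_potential P a A b x :
  slowly_growing P b -> geometric a A b -> Rabs x * b < 1 ->
  PSeries a x = a 0%nat + a 1%nat * x +
    x ^ 2 / 2 * PSeries P x * PSeries (PS_divide_potential P a) x.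
Proof.
  intros HP Ha Hx.
  assert (Hb : 0 < b) by apply HP.
  rewrite Rmult_assoc.
  unfold PS_divide_potential; rewrite PSeries_quotient with (A := Rabs 2 * (A * b ^ 2)) (b := b);
    [|easy | apply (geometric_scal (fun j => a (j + 2)%nat)), geometric_shift, Ha | easy].
  rewrite (PSeries_scal 2 (fun j => a (j + 2)%nat)).
  assert (Hdecr : geometric (PS_decr_1 a) (A * b ^ 1) b).
  { intros n; unfold PS_decr_1; rewrite <- Nat.add_1_r; apply (geometric_shift a A b 1 Ha). }
  rewrite PSeries_decr_1, (PSeries_decr_1 (PS_decr_1 a));
    try (apply CV_radius_inside; eapply geometric_radius; eassumption).
  rewrite (PSeries_ext (PS_decr_1 (PS_decr_1 a)) (fun j => a (j + 2)%nat)).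
  - unfold PS_decr_1; field.
  - intros n; unfold PS_decr_1; f_equal; lia.
Qed.

Lemma locally_0_intro (Q : R -> Prop) e :
  0 < e -> (forall x, Rabs x < e -> Q x) -> locally 0 Q.
Proof.
  intros He H; exists (mkposreal e He); intros x Hx; apply H.
  change (Rabs (x - 0) < e) in Hx; rewrite Rminus_0_r in Hx; easy.
Qed.

Lemma locally_0_elim (Q : R -> Prop) :
  locally 0 Q -> exists e, 0 < e /\ forall x, Rabs x < e -> Q x.
Proof.
  intros [e He]; exists e; split; [apply cond_pos|]; intros x Hx; apply He.
  change (Rabs (x - 0) < e); rewrite Rminus_0_r; easy.
Qed.

Lemma quotient_derivative_of_constant_period g X h eta rho p P b e T d :
  slowly_growing p b -> slowly_growing P b -> 0 < e -> e * b <= 1 / 2 ->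
  (forall x, Rabs x < e -> g x = x * PSeries p x /\ potential g x = x ^ 2 / 2 * PSeries P x) ->
  straightening g X h eta rho ->
  0 < d -> (forall r, 0 < r < d -> orbit_period eta r = T) ->
  exists f, locally 0 (fun u => analytic_at f u) /\
    locally 0 (fun x => is_derive (potential_quotient g) x (f (potential g x))).
Proof.
  intros Hp HP He Heb Hg St Hd HT.
  destruct (potential_quotient_PSeries g p P b e Hp HP Heb Hg) as (q & Hq & HQ).
  assert (Hb : 0 < b) by apply Hp.
  pose proof (geometric_derive q 2 b Hb Hq) as HF.
  (* Differentiating [q] doubled the ratio, so [P] is brought to the same ratio; halving [e] below
     compensates for this. *)
  pose proof (slowly_growing_weaken P b (2 * b) ltac:(lra) HP) as HP2.
  set (B := 2 * b) in *.
  assert (HB : 0 < B) by (unfold B; lra).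
  set (K := fun n => Nat.iter n (PS_divide_potential P) (PS_derive q)).
  assert (HK : forall n, geometric (K n) (B * (4 * B ^ 2) ^ n) B).
  { induction n as [|n IH].
    - simpl; rewrite Rmult_1_r; exact HF.
    - replace (B * (4 * B ^ 2) ^ S n) with (B * (4 * B ^ 2) ^ n * (4 * B ^ 2))
        by (simpl; ring).
      apply geometric_divide_potential; [exact HP2 | exact IH]. }
  set (e' := e / 2).
  assert (Hin : forall x, Rabs x < e' -> Rabs x < e /\ Rabs x * B <= 1 / 2).
  { intros x Hx; unfold e', B in *; split; [lra|].
    apply Rle_trans with (e / 2 * (2 * b)); [apply Rmult_le_compat_r|]; lra. }
  set (F := PSeries (PS_derive q)).
  assert (HQF : forall x, Rabs x < e' -> is_derive (potential_quotient g) x (F x)).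
  { intros x Hx; destruct (Hin x Hx) as [Hxe HxB].
    apply is_derive_ext_loc with (PSeries q).
    - assert (Hr : 0 < e - Rabs x) by lra.
      exists (mkposreal _ Hr); intros y Hy.
      change (Rabs (y - x) < e - Rabs x) in Hy.
      symmetry; apply HQ; pose proof (Rabs_triang_inv y x); lra.
    - apply PSeries_is_derive_geometric with 2 b; [easy..|].
      unfold B in HxB; lra. }
  pose proof (str_rho _ _ _ _ _ St) as Hrho.
  set (m := Rmin rho (e' / 2)).
  assert (Hm : 0 < m /\ m <= rho /\ 2 * m <= e').
  { unfold m, e', Rmin; destruct Rle_dec; lra. }
  assert (Hhm : forall u, Rabs u < m -> Rabs (h u) < e').
  { intros u Hu; pose proof (str_h_bound _ _ _ _ _ St u); lra. }
  assert (Hstep : forall n x, Rabs x < e' -> PSeries (K n) x =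
    K n 0%nat + K n 1%nat * x + potential g x * PSeries (K (S n)) x).
  { intros n x Hx; destruct (Hin x Hx) as [Hxe HxB]; destruct (Hg x Hxe) as [_ ->].
    apply PSeries_divide_potential with (B * (4 * B ^ 2) ^ n) B; [easy | apply HK | lra]. }
  assert (Hvan : forall n,
    (forall u, 0 < u < m -> F (h u) - F (h (- u)) =
      (u ^ 2 / 2) ^ n * (PSeries (K n) (h u) - PSeries (K n) (h (- u)))) ->
    K n 1%nat = 0).
  { intros n Hn; apply (constant_period_vanishing g X h eta rho F T d m
      (K n) (B * (4 * B ^ 2) ^ n) B n); try easy.
    intros u Hu; apply (straightening_eta_derive g X h eta rho); [easy | lra |].
    apply HQF, Hhm; easy. }
  (* In the difference the constant terms cancel, the linear ones vanish by [Hvan], and the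
     potential equals [u ^ 2 / 2] at both points, which yields one more such factor. *)
  assert (Hodd : forall n, forall u, 0 < u < m -> F (h u) - F (h (- u)) =
      (u ^ 2 / 2) ^ n * (PSeries (K n) (h u) - PSeries (K n) (h (- u)))).
  { induction n as [|n IH]; intros u Hu.
    - rewrite pow_O, Rmult_1_l; easy.
    - rewrite (IH u Hu).
      assert (Hu1 : Rabs u < m) by (rewrite Rabs_pos_eq; lra).
      assert (Hu2 : Rabs (- u) < m) by (rewrite Rabs_Ropp; easy).
      rewrite (Hstep n (h u)), (Hstep n (h (- u))), (Hvan n IH) by auto.
      rewrite !(str_potential _ _ _ _ _ St) by lra.
      simpl; field. }
  set (c := fun n => K n 0%nat).
  assert (Hc : geometric c B (4 * B ^ 2)).
  { intros n; pose proof (HK n 0%nat) as H; rewrite pow_O, Rmult_1_r in H; exact H. }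
  assert (HB2 : 0 < 4 * B ^ 2) by (assert (0 < B ^ 2) by (apply pow_lt; easy); lra).
  exists (PSeries c); split.
  - apply locally_0_intro with (/ (4 * (4 * B ^ 2))); [apply Rinv_0_lt_compat; lra|].
    intros u Hu; apply analytic_at_PSeries with B (4 * B ^ 2); [easy..|].
    apply Rle_trans with (/ (4 * (4 * B ^ 2)) * (4 * B ^ 2)).
    + apply Rmult_le_compat_r; lra.
    + right; field; lra.
  - apply locally_0_intro with e'; [unfold e'; lra|].
    intros x Hx; destruct (Hin x Hx) as [Hxe HxB].
    replace (PSeries c (potential g x)) with (F x); [apply HQF; easy|].
    symmetry; apply is_pseries_unique, is_pseries_R.
    apply (iterated_division_series (fun n => PSeries (K n) x) c _ (2 * B) (4 * B ^ 2)).
    + intros n; rewrite Hstep, (Hvan n (Hodd n)) by easy; unfold c; ring.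
    + intros n; eapply Rle_trans; [eapply geometric_PSeries; [exact HB | apply HK | easy]|].
      right; ring.
    + destruct (Hg x Hxe) as [_ ->].
      pose proof (slowly_growing_near_1 P B x HP2 HxB) as H1.
      apply Rabs_le_between in H1.
      (* With [Rabs x * B <= 1 / 2] and [PSeries P x <= 5 / 4] this is at most [5 / 8], so the
         potential lies within the domain of convergence. *)
      replace (4 * B ^ 2 * (x ^ 2 / 2 * PSeries P x))
        with (2 * (x * B) ^ 2 * PSeries P x) by field.
      rewrite <- (pow2_abs (x * B)), (Rabs_mult x B), (Rabs_pos_eq B) by lra.
      assert (0 <= Rabs x * B) by (apply Rmult_le_pos; [apply Rabs_pos | lra]).
      set (t := Rabs x * B) in *.
      assert (0 <= t ^ 2 <= 1 / 4) by nra.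
      rewrite Rabs_pos_eq; nra.
Qed.

Theorem theoremB (g : R -> R)
  (g_analytic : forall x, analytic_at g x)
  (g0 : g 0 = 0)
  (dg0 : is_derive g 0 1)
  (well : exists a b c : R,
     a < 0 < b /\ 0 < c /\ potential g a = c /\ potential g b = c /\
     forall x, a < x < b -> x <> 0 -> potential g x < c /\ 0 < x * g x) :
  isochronous_center_at_origin g <->
  exists f : R -> R,
    locally 0 (fun u => analytic_at f u) /\
    locally 0 (fun x => is_derive (potential_quotient g) x (f (potential g x))).
Proof.
  assert (g_cont : forall x, continuous g x).
  { intros x; apply (ex_derive_continuous (V := R_NormedModule)), analytic_at_ex_derive, g_analytic. }
  destruct (force_normal_form g (g_analytic 0) g0 dg0)
    as (p & P & b & e & Hp & HP & He & Heb & Hg).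
  destruct (straightening_exists g p P b e g_cont Hp HP He Heb Hg)
    as (X & h & eta & rho & St).
  split.
  - intros Hiso.
    destruct (orbit_period_constant g X h eta rho St Hiso) as (T & d & Hd & HT).
    apply (quotient_derivative_of_constant_period g X h eta rho p P b e T d); easy.
  - intros (f & _ & Hf).
    destruct (locally_0_elim _ Hf) as (e1 & He1 & Hf1).
    pose proof (str_rho _ _ _ _ _ St) as Hrho.
    set (d := Rmin rho (e1 / 2)).
    assert (Hd : 0 < d /\ d <= rho /\ 2 * d <= e1).
    { unfold d, Rmin; destruct Rle_dec; lra. }
    (* The derivative depends on [u] only through [u ^ 2], so it is even, and [eta u + eta (- u)]
       keeps its value at 0. *)
    assert (Heta : forall u, Rabs u < d -> is_derive eta u (f (u ^ 2 / 2))).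
    { intros u Hu; rewrite <- (str_potential _ _ _ _ _ St u) by lra.
      apply (straightening_eta_derive g X h eta rho); [easy | lra |].
      apply Hf1; pose proof (str_h_bound _ _ _ _ _ St u); lra. }
    (* The filled-in value [1 / 2] gives [eta 0 ^ 2 = 1], and [eta] is positive. *)
    assert (Heta0 : eta 0 = 1).
    { assert (H0 : Rabs 0 < rho) by (rewrite Rabs_R0; easy).
      pose proof (str_quotient _ _ _ _ _ St 0 H0) as Hsq.
      pose proof (str_eta_lower _ _ _ _ _ St 0).
      rewrite (str_h_0 _ _ _ _ _ St) in Hsq; unfold potential_quotient in Hsq.
      destruct (Req_EM_T 0 0); [nra | easy]. }
    apply (isochronous_of_even_part g X h eta rho d); try easy.
    intros u Hu.
    transitivity (eta 0 + eta (- 0)); [|rewrite Ropp_0, Heta0; ring].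
    symmetry; apply (derive_zero_constant (fun u => eta u + eta (- u))).
    intros s Hs.
    assert (Hsd : Rabs s < d).
    { revert Hu Hs; unfold Rmin, Rmax, Rabs.
      repeat destruct Rle_dec; repeat destruct Rcase_abs; lra. }
    replace 0 with (f (s ^ 2 / 2) - f ((- s) ^ 2 / 2))
      by (replace ((- s) ^ 2) with (s ^ 2) by ring; ring).
    apply is_derive_even_part; apply Heta; rewrite ?Rabs_Ropp; easy.
Qed.
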